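(* Let $A_1,\dots,A_n$ be positive self-adjoint invertible operators on a complex Hilbert space $\mathscr{H}$, with spectra in an interval $J$, such that $\sum_{j=1}^nA_j=I$. If $B=[b_{ij}]$ and $C=[c_{ij}]$ are two $n\times n$ doubly stochastic matrices, then for all $0\le t\le 1$, $$(\log n)I\ \ge\ \sum_{i=1}^n\left[-\left(\sum_{j=1}^n[(1-t)b_{ij}+tc_{ij}]A_j\right)\log\left(\sum_{j=1}^n[(1-t)b_{ij}+tc_{ij}]A_j\right)\right]\ \ge\ -\sum_{j=1}^nA_j\log A_j.$$
   Context: $I$ is the identity operator. A bounded self-adjoint operator $A$ on $\mathscr{H}$ is positive ($A\ge0$) if $\langle Ax,x\rangle\ge0$ for all $x\in\mathscr{H}$; for self-adjoint $A,B$, $A\le B$ means $B-A\ge0$. Functions are applied to self-adjoint operators by continuous functional calculus. An $n\times n$ matrix $[a_{ij}]$ is doubly stochastic if $a_{ij}\ge0$ for all $i,j$, and all its row sums and column sums equal $1$. *)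

(* Defs.v *)
From mathcomp Require Import all_boot all_order all_algebra.
From mathcomp Require Import complex.
From mathcomp Require Import all_classical all_reals all_analysis.

Set Implicit Arguments.
Unset Strict Implicit.
Unset Printing Implicit Defensive.

Import Order.TTheory GRing.Theory Num.Theory.
Import numFieldNormedType.Exports.

Local Open Scope classical_set_scope.
Local Open Scope ring_scope.
Local Open Scope complex_scope.

(* A complex Hilbert space is a complete normed module [H] over [R[i]] with a
   positive definite Hermitian form [ip] inducing its norm. The form is linear
   in its first argument and conjugate-linear in its second one. *)
Definition norm_of_inner_product (R : realType) (H : normedModType R[i])
    (ip : {dot H for Num.conj}) : Prop :=
  forall x : H, `|x| ^+ 2 = ip x x.

(* Operators are plain functions [H -> H], so that the pointwise module
   structure on functions gives their linear combinations. *)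
Section operators.
Variables (R : realType) (H : normedModType R[i]).
Implicit Types (A S T : H -> H).

Definition bounded_operator T : Prop :=
  linear T /\ exists M : R, forall x, `|T x| <= M%:C * `|x|.

Definition invertible_operator T : Prop :=
  exists S, [/\ bounded_operator S, cancel T S & cancel S T].

Definition spectrum T : set R[i] :=
  [set z | ~ invertible_operator (T - z *: idfun)].

Definition real_spectrum T : set R := [set s | spectrum T s%:C].

Definition poly_operator (p : {poly R}) T : H -> H :=
  \sum_(k < size p) (p`_k)%:C *: iter k T.

Definition operator_norm_cvg (S_ : nat -> H -> H) T : Prop :=
  forall e : R, 0 < e ->
    \forall k \near \oo, forall x, `|S_ k x - T x| <= e%:C * `|x|.

(* [T] is [f(A)]: the operator norm limit of [p_k(A)] for real polynomials
   [p_k] converging to [f] uniformly on the spectrum of [A]. As [A] is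
   self-adjoint, its spectrum is real, and for [f] continuous on the spectrum
   such a [T] exists and does not depend on the sequence [p_k]. *)
Definition is_functional_calculus (f : R -> R) A T : Prop :=
  bounded_operator T /\
  exists p : nat -> {poly R},
    {uniform real_spectrum A, (fun k => horner (p k)) @ \oo --> f} /\
    operator_norm_cvg (fun k => poly_operator (p k) A) T.

(* The default value [0] is not meaningful: it is taken only if [f(A)] does
   not exist. *)
Definition functional_calculus (f : R -> R) A : H -> H :=
  xget 0 [set T | is_functional_calculus f A T].

Definition log_operator A : H -> H := functional_calculus (@ln R) A.

Variable ip : {dot H for Num.conj}.

Definition self_adjoint T : Prop :=
  bounded_operator T /\ forall x y, ip (T x) y = ip x (T y).

(* In the order of [R[i]], [0 <= z] means that [z] is real and nonnegative. *)
Definition positive_operator T : Prop :=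
  self_adjoint T /\ forall x, 0 <= ip (T x) x.

Definition operator_le S T : Prop :=
  [/\ self_adjoint S, self_adjoint T & positive_operator (T - S)].

End operators.

Definition doubly_stochastic (R : realType) (n : nat) (B : 'M[R]_n) : Prop :=
  [/\ forall i j, 0 <= B i j,
      forall i, \sum_(j < n) B i j = 1 &
      forall j, \sum_(i < n) B i j = 1].

(* Main.v *)
(* Both bounds are inequalities between quadratic forms of functions of a single
   operator, combined with Jensen's inequality for x log x.

   Order and functional calculus. If p >= 0 on the spectrum of a self-adjoint X,
   then p(X) + l is invertible for every l > 0, by factoring p + l over the
   complex numbers; and a self-adjoint Y such that all Y + l are invertible is
   positive. Hence pointwise inequalities on the spectrum pass to operators, the
   functional calculus is unique, and it exists for uniform limits of
   polynomials.

   Upper bound. -x log x <= (log n - 1) x + 1/n; sum over i, using that the X_i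
   add up to the identity.

   Lower bound. The right Riemann sums of log x = int_0^1 (x - 1) / w_a(x) da,
   where w_a(x) = 1 - a + a x, approximate log x from below with an error of at
   most (x - 1)^2 / (N x). After multiplication by x their terms are affine in x
   and 1 / w_a(x), with a nonnegative coefficient of 1 / w_a(x). Now
   <W^-1 y, y> = max_z (2 Re <y, z> - <W z, z>) is a maximum of functions affine
   in W, hence convex. Letting N tend to infinity gives Jensen's inequality for
   x log x, and summing it over the rows of a doubly stochastic matrix gives the
   claim. *)

Require Import Defs.
From mathcomp Require Import all_boot all_order all_algebra.
From mathcomp Require Import complex.
From mathcomp Require Import all_classical all_reals all_analysis.
From mathcomp Require Import ring lra.

Import Order.TTheory GRing.Theory Num.Theory.
Import numFieldNormedType.Exports.

Local Open Scope classical_set_scope.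
Local Open Scope ring_scope.
Local Open Scope complex_scope.

(** * Bounded operators *)

Section HilbertSpace.
Set Implicit Arguments.
Unset Strict Implicit.
Variables (R : realType) (H : completeNormedModType R[i]).
Implicit Types (x y z : H) (A T S : H -> H) (a c m e : R).

(** The norm of [H] takes values in [R[i]]; its real part allows estimates in the ordered field
    [R]. *)
Definition rnorm x : R := complex.Re `|x|.

Lemma rnormE x : `|x| = (rnorm x)%:C.
Proof. by rewrite /rnorm RRe_real ?ger0_real ?normr_ge0. Qed.

Lemma rnorm_ge0 x : 0 <= rnorm x.
Proof. by rewrite -ler0c -rnormE. Qed.

Lemma rnorm_eq0 x : rnorm x = 0 -> x = 0.
Proof. by move=> h; apply/eqP; rewrite -normr_eq0 rnormE h. Qed.

Lemma rnorm_triangle x y : rnorm (x + y) <= rnorm x + rnorm y.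
Proof. by have := ler_normD x y; rewrite !rnormE -rmorphD lecR. Qed.

Lemma rnormB x y : rnorm (x - y) = rnorm (y - x).
Proof. by rewrite /rnorm distrC. Qed.

Lemma rnormZ (w : R[i]) x : rnorm (w *: x) = complex.Re `|w| * rnorm x.
Proof.
by rewrite /rnorm normrZ (rnormE x) -(RRe_real (ger0_real (normr_ge0 w)))
  -rmorphM.
Qed.

Lemma rnormZr a x : rnorm (a%:C *: x) = `|a| * rnorm x.
Proof. by rewrite rnormZ normc_def /= expr0n /= addr0 sqrtr_sqr. Qed.

Lemma rnorm_triangle3 y x z : rnorm (x - z) <= rnorm (x - y) + rnorm (y - z).
Proof. by rewrite -[x - z](subrKA y); exact: rnorm_triangle. Qed.

Lemma linear_add T : linear T -> {morph T : x y / x + y}.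
Proof. by move=> l x y; rewrite -[x]scale1r l !scale1r. Qed.

Lemma linear0_op T : linear T -> T 0 = 0.
Proof. by move=> l; apply: (addrI (T 0)); rewrite -linear_add// !addr0. Qed.

Lemma linear_scale T : linear T -> forall (w : R[i]) x, T (w *: x) = w *: T x.
Proof. by move=> l w x; rewrite -[w *: x]addr0 l linear0_op// addr0. Qed.

Lemma linear_opp T : linear T -> {morph T : x / - x}.
Proof. by move=> l x; rewrite -scaleN1r linear_scale// scaleN1r. Qed.

Lemma linear_sub T : linear T -> {morph T : x y / x - y}.
Proof. by move=> l x y; rewrite linear_add// linear_opp. Qed.

Lemma bounded_operatorP T :
  bounded_operator T <-> linear T /\ exists2 M, 0 <= M & forall x, rnorm (T x)
    <= M * rnorm x.
Proof.
split=> -[l [M]].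
  move=> hM; split=> //; exists (Num.max M 0);
    first by rewrite le_max lexx orbT.
  move=> x; have := hM x; rewrite !rnormE -rmorphM lecR => /le_trans; apply.
  by rewrite ler_wpM2r ?rnorm_ge0// le_max lexx.
by move=> M0 hM; split=> //; exists M => x; rewrite !rnormE -rmorphM lecR.
Qed.

Lemma bounded_linear T : bounded_operator T -> linear T. Proof. by case. Qed.

Lemma bounded_id : bounded_operator (idfun : H -> H).
Proof. by apply/bounded_operatorP; split=> //; exists 1 => // x;
  rewrite mul1r. Qed.

Lemma boundedD S T : bounded_operator S -> bounded_operator T ->
  bounded_operator (S + T).
Proof.
move=> /bounded_operatorP[lS [M M0 hM]] /bounded_operatorP[lT [N N0 hN]].
apply/bounded_operatorP; split=> [w x y|].
  by rewrite !fctE lS lT scalerDr addrACA.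
exists (M + N) => [|x]; first exact: addr_ge0.
by rewrite mulrDl (le_trans (rnorm_triangle _ _))// lerD.
Qed.

Lemma boundedZ (w : R[i]) T : bounded_operator T -> bounded_operator (w *: T).
Proof.
move=> /bounded_operatorP[lT [M M0 hM]].
have w0 : 0 <= complex.Re `|w| by rewrite -ler0c RRe_real ?ger0_real.
apply/bounded_operatorP; split=> [v x y|].
  by rewrite !fctE lT scalerDr !scalerA mulrC.
exists (complex.Re `|w| * M) => [|x]; first exact: mulr_ge0.
by rewrite fctE rnormZ -mulrA ler_wpM2l.
Qed.

Lemma bounded0 : bounded_operator (0 : H -> H).
Proof. by rewrite -(scale0r idfun); apply: boundedZ; exact: bounded_id. Qed.

Lemma boundedN T : bounded_operator T -> bounded_operator (- T).
Proof. by move=> bT; rewrite -scaleN1r; exact: boundedZ. Qed.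

Lemma boundedB S T : bounded_operator S -> bounded_operator T ->
  bounded_operator (S - T).
Proof. by move=> bS bT; apply: boundedD => //; exact: boundedN. Qed.

Lemma bounded_comp S T : bounded_operator S -> bounded_operator T ->
  bounded_operator (S \o T).
Proof.
move=> /bounded_operatorP[lS [M M0 hM]] /bounded_operatorP[lT [N N0 hN]].
apply/bounded_operatorP; split=> [w x y|]; first by rewrite /= lT lS.
exists (M * N) => [|x]; first exact: mulr_ge0.
by rewrite -mulrA (le_trans (hM _))// ler_wpM2l.
Qed.

Lemma invertible_comp S T :
  invertible_operator S -> invertible_operator T -> invertible_operator
    (S \o T).
Proof.
move=> [S' [bS SK KS]] [T' [bT TK KT]]; exists (T' \o S'); split.
- exact: bounded_comp.
- by move=> x /=; rewrite SK TK.
- by move=> x /=; rewrite KT KS.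
Qed.

Lemma invertible_id : invertible_operator (idfun : H -> H).
Proof. by exists idfun; split=> //; exact: bounded_id. Qed.

Lemma invertibleZ (w : R[i]) T : w != 0 -> bounded_operator T ->
  invertible_operator T -> invertible_operator (w *: T).
Proof.
move=> w0 [lT _] [S [bS SK KS]]; exists (w^-1 *: S); split.
- exact: boundedZ.
- by move=> x; rewrite !fctE (linear_scale (bounded_linear bS)) scalerA mulVf//
  SK scale1r.
- by move=> x; rewrite !fctE linear_scale// scalerA mulfV// KS scale1r.
Qed.

(** With [U] inverse to [S \o T], the operator [T \o U] is a right inverse of [S]; it is also a left
    inverse because commutation of [S] with [T] makes [U] commute with [S]. *)
Lemma invertible_factor S T : bounded_operator T -> S \o T =1 T \o S ->
  invertible_operator (S \o T) -> invertible_operator S.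
Proof.
move=> bT ST [U [bU UK KU]]; exists (T \o U); split.
- exact: bounded_comp.
- move=> x /=; have e : S (T (U x)) = x := KU x.
  have c v : S (T v) = T (S v) := ST v.
  have SU : U (S x) = S (U x) by rewrite -{1}e c; exact: UK.
  by rewrite SU -c.
- by move=> x; exact: KU.
Qed.

(** The rate survives in the conclusion, so later limits are explicit estimates; this serves the
    Richardson iteration and the construction of [f(X)]. *)
Lemma cauchy_limit (u : nat -> H) (r : R) : 0 <= r ->
    (forall k l : nat, rnorm (u k - u l) <= (k.+1%:R^-1 + l.+1%:R^-1) * r) ->
  exists y, forall k : nat, rnorm (u k - y) <= k.+1%:R^-1 * r.
Proof.
move=> r0 hu.
have inv_lt (e : R) : 0 < e -> exists N : nat, N.+1%:R^-1 * r < e.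
  move=> e0; have d0 : 0 < e / (r + 1) by rewrite divr_gt0// ltr_wpDl.
  have [N _ /(_ N (leqnn N)) /= hN] := near_infty_natSinv_lt (PosNum d0).
  exists N; apply: le_lt_trans (_ : N.+1%:R^-1 * (r + 1) < _).
    by rewrite ler_wpM2l ?invr_ge0// lerDl.
  by rewrite -ltr_pdivlMr ?ltr_wpDl.
have : cvg (u @ \oo).
  apply: cauchy_cvg; apply: cauchy_exP => w w0.
  have wE : w = (complex.Re w)%:C by rewrite RRe_real ?gtr0_real.
  have /inv_lt[N hN] : 0 < complex.Re w / 2 by rewrite divr_gt0// -ltcR -wE.
  exists (u N), N => // k /= Nk.
  rewrite -ball_normE/= wE rnormE ltcR; apply: le_lt_trans (hu _ _) _.
  have kN : k.+1%:R^-1 <= N.+1%:R^-1 :> R by rewrite lef_pV2 ?posrE// ler_nat.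
  have kNr : k.+1%:R^-1 * r <= N.+1%:R^-1 * r by rewrite ler_wpM2r.
  by rewrite mulrDl (splitr (complex.Re w)) ltrD// (le_lt_trans kNr).
move=> /cvg_ex[y uy]; exists y => k; apply/ler_addgt0Pr => e e0.
have /inv_lt[N1 hN] : 0 < e / 2 by rewrite divr_gt0.
have e2 : 0 < (e / 2)%:C by rewrite ltcR divr_gt0.
have [N2 _ hN2] : \forall n \near \oo, `|u n - y| < (e / 2)%:C by exact:
  (cvgr_distC_lt u y uy).

have := hN2 (maxn N1 N2) (leq_maxr _ _); rewrite /= rnormE ltcR => h2.
have := hu k (maxn N1 N2); rewrite mulrDl => h1.
have := rnorm_triangle3 (u (maxn N1 N2)) (u k) y => h3.
have h4 : (maxn N1 N2).+1%:R^-1 * r <= N1.+1%:R^-1 * r.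
  by rewrite ler_wpM2r// lef_pV2 ?posrE// ler_nat ltnS leq_maxl.
apply: le_trans h3 _; rewrite (splitr e) addrA; apply: lerD (ltW h2).
by apply: le_trans h1 _; rewrite lerD2l; exact: le_trans h4 (ltW hN).
Qed.

End HilbertSpace.

(** * The real inner product *)

Section InnerProduct.
Set Implicit Arguments.
Unset Strict Implicit.
Variables (R : realType) (H : completeNormedModType R[i]).
Variables (ip : {dot H for Num.conj}) (ip_norm : norm_of_inner_product ip).
Implicit Types (x y z : H) (A T S : H -> H) (a c m e : R).

Lemma Re_conjC (w : R[i]) : complex.Re (Num.conj w) = complex.Re w.
Proof. by case: w. Qed.

Lemma Im_conjC (w : R[i]) : complex.Im (Num.conj w) = - complex.Im w.
Proof. by case: w. Qed.

Lemma Re_mulr a (w : R[i]) : complex.Re (a%:C * w) = a * complex.Re w.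
Proof. by case: w => u v /=; rewrite mul0r subr0. Qed.

Lemma Re_muli (w : R[i]) : complex.Re ('i * w) = - complex.Im w.
Proof. by case: w => u v /=; rewrite mul0r sub0r mul1r. Qed.

Definition rdot x y : R := complex.Re (ip x y).

Lemma rdotC x y : rdot x y = rdot y x.
Proof.
by rewrite /rdot (hermitian_subproof x y) expr0 mul1r Re_conjC.
Qed.

Lemma rdotDl x y z : rdot (x + y) z = rdot x z + rdot y z.
Proof. by rewrite /rdot linearDl raddfD. Qed.

Lemma rdot0l z : rdot 0 z = 0.
Proof. by rewrite /rdot linear0l. Qed.

Lemma rdotNl x z : rdot (- x) z = - rdot x z.
Proof. by rewrite /rdot linearNl raddfN. Qed.

Lemma rdotBl x y z : rdot (x - y) z = rdot x z - rdot y z.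
Proof. by rewrite rdotDl rdotNl. Qed.

Lemma rdotZl a x z : rdot (a%:C *: x) z = a * rdot x z.
Proof.
by rewrite /rdot linearZl_LR Re_mulr.
Qed.

Lemma rdotDr x y z : rdot z (x + y) = rdot z x + rdot z y.
Proof. by rewrite !(rdotC z) rdotDl. Qed.

Lemma rdotNr x z : rdot z (- x) = - rdot z x.
Proof. by rewrite !(rdotC z) rdotNl. Qed.

Lemma rdotBr x y z : rdot z (x - y) = rdot z x - rdot z y.
Proof. by rewrite !(rdotC z) rdotBl. Qed.

Lemma rdotZr a x z : rdot z (a%:C *: x) = a * rdot z x.
Proof. by rewrite !(rdotC z) rdotZl. Qed.

Lemma rdot_suml (I : Type) (r : seq I) (P : pred I) (F : I -> H) z :
  rdot (\sum_(i <- r | P i) F i) z = \sum_(i <- r | P i) rdot (F i) z.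
Proof.
elim/big_ind2 : _ => [|_ x _ y <- <-|//]; last exact: rdotDl.
exact: rdot0l.
Qed.

Lemma rdotxx x : rdot x x = rnorm x ^+ 2.
Proof. by rewrite /rdot -ip_norm rnormE -rmorphXn. Qed.

Lemma rdotxx_ge0 x : 0 <= rdot x x.
Proof. by rewrite rdotxx exprn_ge0 ?rnorm_ge0. Qed.

Definition hermitian T := forall x y, rdot (T x) y = rdot x (T y).
Definition psd T := forall x, 0 <= rdot (T x) x.

(** The quadratic [t |-> <T (x + t y), x + t y>] is nonnegative on the real line, so its
    discriminant is not positive. *)
Lemma psd_cauchy_schwarz T : linear T -> hermitian T -> psd T ->
  forall x y, rdot (T x) y ^+ 2 <= rdot (T x) x * rdot (T y) y.
Proof.
move=> lT hT pT x y.
have key t : 0 <= rdot (T x) x + 2 * t * rdot (T x) y + t ^+ 2 * rdot (T y) y.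
  have := pT (x + t%:C *: y).
  rewrite linear_add// linear_scale// !(rdotDl, rdotDr, rdotZl, rdotZr).
  by rewrite (hT y) (rdotC y (T x)) => /le_trans; apply; rewrite le_eqVlt;
    apply/orP; left; apply/eqP; ring.
have := pT x; have := pT y.
move: (rdot (T x) x) (rdot (T x) y) (rdot (T y) y) key => p q s key s0 p0.
have [s00|sN0] := eqVneq s 0; last first.
  (* The quadratic is minimal at [t = - q / s]. *)
  have := key (- q / s); have : 0 < s by rewrite lt_def sN0.
  move=> sp h; rewrite -subr_ge0.
  have -> : p * s - q ^+ 2 = (p + 2 * (- q / s) * q + (- q / s) ^+ 2 * s) * s by
    field.
  by rewrite mulr_ge0.
rewrite s00 mulr0; have [->|qN0] := eqVneq q 0; first by rewrite expr0n.
(* For [s = 0] the quadratic is affine in [t], and this [t] would give it the value -1. *)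
have := key (- (p + 1) / (2 * q)); rewrite s00 mulr0 addr0.
have -> : 2 * (- (p + 1) / (2 * q)) * q = - (p + 1) by field.
lra.
Qed.

Lemma rdot_cauchy_schwarz x y : rdot x y ^+ 2 <= rdot x x * rdot y y.
Proof. by apply: (@psd_cauchy_schwarz idfun) => // z; exact: rdotxx_ge0. Qed.

Lemma rdot_le x y : rdot x y <= rnorm x * rnorm y.
Proof.
rewrite (le_trans (ler_norm _))// -ler_sqr ?nnegrE ?mulr_ge0 ?rnorm_ge0//.
by rewrite real_normK ?num_real// exprMn -!rdotxx rdot_cauchy_schwarz.
Qed.

(** Cauchy-Schwarz at [x] and [T x] bounds [|T x|^4] by [<T x, x> <T (T x), T x>], and a factor
    [|T x|^2] cancels. *)
Lemma psd_sqr_le T K : linear T -> hermitian T -> psd T ->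
  (forall x, rdot (T x) x <= K * rnorm x ^+ 2) ->
  forall x, rnorm (T x) ^+ 2 <= K * rdot (T x) x.
Proof.
move=> lT hT pT hK x.
have [Tx0|Tx0] := eqVneq (rnorm (T x)) 0.
  by move: Tx0 => /rnorm_eq0 ->; rewrite rdot0l mulr0 -rdotxx rdot0l.
have Tx_gt0 : 0 < rnorm (T x) ^+ 2 by rewrite exprn_gt0// lt_def Tx0 rnorm_ge0.
rewrite -(ler_pM2r Tx_gt0) -{1 2}rdotxx -expr2.
apply: (le_trans (psd_cauchy_schwarz lT hT pT x (T x))).
by rewrite mulrAC mulrC ler_wpM2r.
Qed.

(** Real parts determine the form: the imaginary part of [<T x, y>] is minus the real part of
    [<T (i x), y>]. *)
Lemma self_adjointP T : self_adjoint ip T <-> bounded_operator T /\ hermitian T.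
Proof.
split=> -[bT hT]; split=> // x y; first by rewrite /rdot hT.
apply/eqP; rewrite eq_complex; apply/andP; split; apply/eqP; first exact: hT.
apply: oppr_inj; rewrite -!Re_muli; have := hT ('i *: x) y.
by rewrite /rdot (linear_scale (bounded_linear bT)) !linearZl_LR.
Qed.

Lemma positive_operatorP T :
  positive_operator ip T <-> [/\ bounded_operator T, hermitian T & psd T].
Proof.
split=> [[/self_adjointP[bT hT] pT]|[bT hT pT]].
  by split=> // x; have := pT x; rewrite lecE => /andP[].
have sT : self_adjoint ip T by apply/self_adjointP.
split=> // x; rewrite lecE (pT x) andbT.
have e : ip (T x) x = Num.conj (ip x (T x)).
  by rewrite (hermitian_subproof (T x) x) expr0 mul1r.
by move/(congr1 (@complex.Im R)): e; rewrite Im_conjC -sT.2 => e; apply/eqP;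
  lra.
Qed.

End InnerProduct.

(** * Self-adjoint operators *)

Section SelfAdjoint.
Set Implicit Arguments.
Unset Strict Implicit.
Variables (R : realType) (H : completeNormedModType R[i]).
Variables (ip : {dot H for Num.conj}) (ip_norm : norm_of_inner_product ip).
Implicit Types (x y z : H) (A T S X Y Z : H -> H) (a c m e : R).
Local Notation rdot := (rdot ip).
Local Notation self_adjoint := (self_adjoint ip).

Lemma self_adjoint_id : self_adjoint idfun.
Proof. by split=> //; exact: bounded_id. Qed.

Lemma self_adjointD S T : self_adjoint S -> self_adjoint T -> self_adjoint
  (S + T).
Proof.
move=> /self_adjointP[bS hS] /self_adjointP[bT hT]; apply/self_adjointP.
split=> [|x y]; first exact: boundedD.
by rewrite !fctE rdotDl rdotDr hS hT.
Qed.

Lemma self_adjointZ a T : self_adjoint T -> self_adjoint (a%:C *: T).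
Proof.
move=> /self_adjointP[bT hT]; apply/self_adjointP; split=> [|x y].
  exact: boundedZ.
by rewrite !fctE rdotZl rdotZr hT.
Qed.

Lemma self_adjointN T : self_adjoint T -> self_adjoint (- T).
Proof.
move=> /self_adjointP[bT hT]; apply/self_adjointP; split=> [|x y].
  exact: boundedN.
by rewrite !fctE rdotNl rdotNr hT.
Qed.

Lemma self_adjointB S T : self_adjoint S -> self_adjoint T -> self_adjoint
  (S - T).
Proof. by move=> sS sT; apply: self_adjointD => //; exact: self_adjointN. Qed.

Lemma self_adjoint_sum (I : Type) (r : seq I) (P : pred I) (F : I -> H -> H) :
  (forall i, P i -> self_adjoint (F i)) -> self_adjoint
    (\sum_(i <- r | P i) F i).
Proof.
move=> hF; elim/big_ind : _ => //; last exact: self_adjointD.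
by rewrite -(scale0r idfun); apply: (@self_adjointZ 0); exact: self_adjoint_id.
Qed.

Lemma self_adjoint_comp S T : self_adjoint S -> self_adjoint T ->
  S \o T =1 T \o S -> self_adjoint (S \o T).
Proof.
move=> /self_adjointP[bS hS] /self_adjointP[bT hT] ST; apply/self_adjointP.
split=> [|x y]; first exact: bounded_comp.
by rewrite /= hS hT -[T (S y)]/((T \o S) y) -ST.
Qed.

Lemma rdot_bounded T : bounded_operator T ->
  exists2 M, 0 < M & forall x, `|rdot (T x) x| <= M * rnorm x ^+ 2.
Proof.
move=> /bounded_operatorP[lT [M M0 hM]]; exists (M + 1);
  first by rewrite ltr_wpDl.
move=> x; have h : rnorm (T x) * rnorm x <= (M + 1) * rnorm x ^+ 2.
  rewrite expr2 mulrA ler_wpM2r ?rnorm_ge0// (le_trans (hM x))//.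
  by rewrite ler_wpM2r ?rnorm_ge0// lerDl.
rewrite ler_norml (le_trans (rdot_le ip_norm _ _) h) andbT.
rewrite lerNl -rdotNl (le_trans (rdot_le ip_norm _ _))//.
by rewrite /rnorm normrN.
Qed.

Definition coercive c T := forall x, c * rnorm x ^+ 2 <= rdot (T x) x.

Lemma coercive_le c T : coercive c T -> forall x, c * rnorm x <= rnorm (T x).
Proof.
move=> cT x; have [->|x0] := eqVneq (rnorm x) 0;
  first by rewrite mulr0 rnorm_ge0.
have xp : 0 < rnorm x by rewrite lt_def x0 rnorm_ge0.
by rewrite -(ler_pM2r xp) -mulrA -expr2 (le_trans (cT x))// (rdot_le ip_norm).
Qed.

(** Each of the [k + 1] summands of [1 + th + ... + th ^ k] is at least [th ^ k]. This turns
    geometric decay into the rate that [cauchy_limit] expects. *)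
Lemma geometric_harmonic (th : R) (k : nat) : 0 <= th < 1 ->
  th ^+ k <= k.+1%:R^-1 * (1 - th)^-1.
Proof.
move=> /andP[th0 th1]; have th1' : 0 < 1 - th by rewrite subr_gt0.
rewrite -invfM -(ler_pM2r (mulr_gt0 (ltr0Sn R k) th1')).
rewrite mulVf; last by rewrite gt_eqF// mulr_gt0.
apply: (@le_trans _ _ (1 - th ^+ k.+1));
  last by rewrite lerBlDr lerDl exprn_ge0.
elim: k => [|k ih]; first by rewrite expr0 expr1 !mul1r.
have tk1 : th ^+ k.+1 <= 1 by rewrite exprn_ile1// ltW.
move: ih; rewrite -(natr1 k.+1) (exprS _ k.+1) (exprS _ k).
rewrite exprS in tk1; move: (th ^+ k) (k.+1%:R : R) tk1 => t n tk1 ih.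
have h1 := ler_wpM2l th0 ih.
have h2 : 0 <= (1 - th) * (1 - th * t) by apply: mulr_ge0;
  [exact: ltW|rewrite subr_ge0].
apply: le_trans (_ : th * (t * (n * (1 - th))) + th * t * (1 - th) <= _).
  by rewrite le_eqVlt; apply/orP; left; apply/eqP; ring.
rewrite -subr_ge0 in h1; rewrite -subr_ge0.
have := addr_ge0 h1 h2; move=> /le_trans; apply.
by rewrite le_eqVlt; apply/orP; left; apply/eqP; ring.
Qed.

Lemma le_harmonic0 a c : (forall k : nat, a <= k.+1%:R^-1 * c) -> a <= 0.
Proof.
move=> h; rewrite leNgt; apply/negP => a0.
have c0 : 0 < c by have := h 0; rewrite invr1 mul1r; exact: lt_le_trans.
have d0 : 0 < a / c by rewrite divr_gt0.
have [N _ /(_ N (leqnn N)) /=] := near_infty_natSinv_lt (PosNum d0).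
by rewrite ltr_pdivlMr// ltNge h.
Qed.

Lemma rnorm_harmonic_eq x y c :
  (forall k : nat, rnorm (x - y) <= k.+1%:R^-1 * c) -> x = y.
Proof.
move=> /le_harmonic0 h; apply/eqP; rewrite -subr_eq0; apply/eqP/rnorm_eq0.
by apply/eqP; rewrite eq_le h rnorm_ge0.
Qed.

(* Richardson iteration: the residual x - Y v is multiplied at every step by the
   contraction I - Y / K. *)
Lemma coercive_surjective c Y : 0 < c -> self_adjoint Y -> coercive c Y ->
  forall x, exists y, Y y = x.
Proof.
move=> c0 /self_adjointP[bY hY] cY x; have lY := bounded_linear bY.
have [M M0 hM] := rdot_bounded bY.
(* As [Y <= M <= K] and [c <= K], the form of [Z = I - Y / K] lies between 0 and [th = 1 - c / K],
   and [0 <= th < 1]. *)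
pose K := M + c; have K0 : 0 < K by rewrite addr_gt0.
pose Z := idfun - K^-1%:C *: Y.
have lZ : linear Z.
  by apply: bounded_linear; apply: boundedB;
    [exact: bounded_id|exact: boundedZ].
have hZ : hermitian ip Z.
  by move=> u v; rewrite /Z !fctE rdotBl rdotBr rdotZl rdotZr hY.
have ZE u : rdot (Z u) u = rnorm u ^+ 2 - K^-1 * rdot (Y u) u.
  by rewrite /Z !fctE rdotBl rdotZl (rdotxx ip_norm).
pose th := 1 - c / K.
have th01 : 0 <= th < 1.
  rewrite /th subr_ge0 ltrBlDr ltrDl divr_gt0// andbT ler_pdivrMr// mul1r.
  by rewrite lerDr ltW.
have [th0 th1] := andP th01.
have pZ : psd ip Z.
  move=> u; rewrite ZE subr_ge0 mulrC ler_pdivrMr// mulrC.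
  apply: le_trans (ler_norm _) _; apply: le_trans (hM u) _.
  by rewrite ler_wpM2r ?exprn_ge0 ?rnorm_ge0// lerDl ltW.
have ZK u : rdot (Z u) u <= th * rnorm u ^+ 2.
  rewrite ZE /th mulrBl mul1r lerD2l lerN2 (mulrC c) -mulrA ler_wpM2l//.
  by rewrite invr_ge0 ltW.
have Zth u : rnorm (Z u) <= th * rnorm u.
  rewrite -ler_sqr ?nnegrE ?mulr_ge0 ?rnorm_ge0//.
  apply: le_trans (psd_sqr_le ip_norm lZ hZ pZ ZK u) _.
  by rewrite exprMn expr2 -mulrA ler_wpM2l.
pose v := fix v (k : nat) := if k is l.+1 then v l + K^-1%:C *: (x - Y (v l))
  else 0.
have vS k : v k.+1 = v k + K^-1%:C *: (x - Y (v k)) by [].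
have res k : rnorm (x - Y (v k)) <= th ^+ k * rnorm x.
  elim: k => [|k ih]; first by rewrite linear0_op// subr0 expr0 mul1r.
  have -> : x - Y (v k.+1) = Z (x - Y (v k)).
    by rewrite vS (linear_add lY) (linear_scale lY) opprD addrA.
  by rewrite (le_trans (Zth _))// exprS -mulrA ler_wpM2l.
have resh k : rnorm (x - Y (v k)) <= k.+1%:R^-1 * ((1 - th)^-1 * rnorm x).
  apply: le_trans (res k) _; rewrite mulrA ler_wpM2r ?rnorm_ge0//.
  exact: geometric_harmonic.
(* Coercivity bounds [|v k - v l|] by [c^-1] times the difference of the residuals, so small
   residuals make [v] a Cauchy sequence. *)
have [||y hy] := @cauchy_limit _ _ v (c^-1 * ((1 - th)^-1 * rnorm x)).
- by rewrite !mulr_ge0 ?rnorm_ge0 ?invr_ge0 ?subr_ge0 ?(ltW c0) ?(ltW th1).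
- move=> k l; rewrite mulrCA ler_pdivlMl//.
  apply: le_trans (coercive_le cY _) _; rewrite linear_sub//.
  apply: le_trans (rnorm_triangle3 x _ _) _; rewrite mulrDl lerD//.
  by rewrite rnormB.
exists y; have [_ [L L0 hL]] := (bounded_operatorP _).1 bY.
apply: (@rnorm_harmonic_eq _ _
  (L * (c^-1 * ((1 - th)^-1 * rnorm x)) + (1 - th)^-1 * rnorm x)).
move=> k; apply: le_trans (rnorm_triangle3 (Y (v k)) _ _) _.
rewrite mulrDr lerD// ?(rnormB _ x)//.
rewrite -linear_sub// (le_trans (hL _))// mulrCA ler_wpM2l//.
by rewrite rnormB.
Qed.

Lemma coercive_invertible c Y : 0 < c -> self_adjoint Y -> coercive c Y ->
  invertible_operator Y.
Proof.
move=> c0 sY cY; have := coercive_surjective c0 sY cY;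
  have lY := bounded_linear sY.1.
move=> /choice[S YS].
have injY : injective Y.
  move=> x y xy; apply/eqP; rewrite -subr_eq0; apply/eqP/rnorm_eq0.
  apply/eqP; rewrite eq_le rnorm_ge0 andbT.
  have := coercive_le cY (x - y); rewrite linear_sub// xy subrr.
  by rewrite {2}/rnorm normr0 pmulr_rle0.
exists S; split=> [|x|//]; last by apply: injY; rewrite YS.
apply/bounded_operatorP; split=> [w x y|].
  by apply: injY; rewrite (linear_add lY) (linear_scale lY) !YS.
exists c^-1; first by rewrite invr_ge0 ltW.
by move=> x; rewrite ler_pdivlMl// (le_trans (coercive_le cY _))// YS.
Qed.

(** For [w = a + i b], the product [(X - a - i b) (X - a + i b) = (X - a)^2 + b^2] is coercive with
    constant [b^2], and its two factors commute. *)
Lemma nonreal_invertible X (w : R[i]) : self_adjoint X -> complex.Im w != 0 ->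
  invertible_operator (X - w *: idfun).
Proof.
move=> sX; case: w => a b /= b0.
pose D := X - a%:C *: idfun.
have sD : self_adjoint D.
  by apply: self_adjointB => //; apply: self_adjointZ; exact: self_adjoint_id.
have lD := bounded_linear sD.1.
pose w := (0 +i* b : R[i]).
have PE : X - (a +i* b) *: idfun = D - w *: idfun.
  rewrite /D -addrA -opprD -scalerDl; congr (_ - _ *: _).
  apply/eqP; rewrite eq_complex /w /=. by apply/andP; split; apply/eqP;
    rewrite ?addr0 ?add0r.
have bQ : bounded_operator (D + w *: idfun).
  by apply: boundedD; [exact: sD.1|apply: boundedZ; exact: bounded_id].
have ww : w * w = - (b ^+ 2)%:C.
  by apply/eqP; rewrite eq_complex /=; apply/andP; split; apply/eqP; ring.
have PQ : (D - w *: idfun) \o (D + w *: idfun) = D \o D + (b ^+ 2)%:C *: idfun.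
  apply/funext => x; rewrite !fctE /=.
  rewrite (linear_add lD) (linear_scale lD) (scalerDr w (D x)) scalerA ww
    scaleNr.
  by rewrite opprD opprK addrA addrK.
have QP : (D + w *: idfun) \o (D - w *: idfun) = D \o D + (b ^+ 2)%:C *: idfun.
  apply/funext => x; rewrite !fctE /=.
  rewrite (linear_sub lD) (linear_scale lD) (scalerBr w (D x)) scalerA ww
    scaleNr.
  by rewrite opprK addrA subrK.
rewrite PE; apply: invertible_factor bQ _ _; first by rewrite PQ QP.
rewrite PQ; apply: (@coercive_invertible (b ^+ 2)).
- by rewrite exprn_even_gt0.
- apply: self_adjointD; first exact: self_adjoint_comp.
  by apply: self_adjointZ; exact: self_adjoint_id.
- move=> x; rewrite !fctE rdotDl rdotZl (rdotxx ip_norm) lerDr.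
  have /self_adjointP[_ ->] := sD.
  by rewrite (rdotxx_ge0 ip_norm).
Qed.

(** If [N] bounds the inverse and [K] the form of [Z], then
    [|x|^2 <= N^2 |Z x|^2 <= N^2 K <Z x, x>]. *)
Lemma psd_invertible_coercive Z : self_adjoint Z -> psd ip Z ->
  invertible_operator Z -> exists2 c, 0 < c & coercive c Z.
Proof.
move=> /self_adjointP[bZ hZ] pZ [S [/bounded_operatorP[_ [N N0 hN]] SK _]].
have [K K0 hK] := rdot_bounded bZ.
have NK0 : 0 <= N ^+ 2 * K by rewrite mulr_ge0 ?exprn_ge0// ltW.
have d0 : 0 < N ^+ 2 * K + 1 by rewrite ltr_wpDl.
exists (N ^+ 2 * K + 1)^-1; first by rewrite invr_gt0.
move=> x; rewrite ler_pdivrMl//.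
apply: (@le_trans _ _ (N ^+ 2 * K * rdot (Z x) x)); last first.
  by rewrite ler_wpM2r// lerDl.
apply: (@le_trans _ _ (N ^+ 2 * rnorm (Z x) ^+ 2)).
  by rewrite -exprMn ler_sqr ?nnegrE ?mulr_ge0 ?rnorm_ge0// -{1}(SK x).
rewrite -mulrA ler_wpM2l ?exprn_ge0//.
apply: (psd_sqr_le ip_norm) => // [|y]; first exact: bounded_linear.
exact: le_trans (ler_norm _) (hK y).
Qed.

(* Otherwise, with m < 0 the infimum of the numerical range, Y - m would be
   positive and invertible, hence coercive, contradicting the choice of m. *)
Lemma psd_of_resolvent Y : self_adjoint Y ->
  (forall l, 0 < l -> invertible_operator (Y + l%:C *: idfun)) -> psd ip Y.
Proof.
move=> sY inv x0; rewrite leNgt; apply/negP => q0.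
have x0p : 0 < rnorm x0 ^+ 2.
  rewrite lt_def exprn_ge0 ?rnorm_ge0// andbT expf_eq0/=;
    apply/eqP => /rnorm_eq0 x00.
  by move: q0; rewrite x00 linear0_op ?rdot0l ?ltxx//;
    exact: bounded_linear sY.1.
(* The supremum of [E] is the infimum of the numerical range of [Y]; it belongs to [E], and [x0]
   makes it negative. *)
pose E := [set m | coercive m Y].
have ub m : E m -> m <= rdot (Y x0) x0 / rnorm x0 ^+ 2.
  by move=> Em; rewrite ler_pdivlMr.
have [M M0 hM] := rdot_bounded sY.1.
have supE : has_sup E.
  split; last by exists (rdot (Y x0) x0 / rnorm x0 ^+ 2) => m; exact: ub.
  exists (- M) => x; have := hM x; rewrite ler_norml mulNr => /andP[//].
pose m := sup E.
have Em : E m.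
  move=> x; have [x20|xN0] := eqVneq (rnorm x ^+ 2) 0.
    rewrite x20 mulr0; move/eqP: x20; rewrite expf_eq0 /= => /eqP/rnorm_eq0 ->.
    by rewrite linear0_op ?rdot0l//; exact: bounded_linear sY.1.
  have xp : 0 < rnorm x ^+ 2 by rewrite lt_def xN0 exprn_ge0 ?rnorm_ge0.
  rewrite -ler_pdivlMr//; apply: ge_sup; first exact: supE.1.
  by move=> l El /=; rewrite ler_pdivlMr.
have m0 : m < 0.
  by apply: le_lt_trans (ub _ Em) _; rewrite ltr_pdivrMr// mul0r.
pose Z := Y + (- m)%:C *: idfun.
have ZE x : rdot (Z x) x = rdot (Y x) x - m * rnorm x ^+ 2.
  by rewrite /Z !fctE rdotDl rdotZl (rdotxx ip_norm) mulNr.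
have sZ : self_adjoint Z.
  by apply: self_adjointD => //; apply: self_adjointZ; exact: self_adjoint_id.
have [||c c0 cZ] := psd_invertible_coercive sZ.
- by move=> x; rewrite ZE subr_ge0; exact: Em.
- by apply: inv; rewrite oppr_gt0.
have : E (m + c) by move=> x; have := cZ x; rewrite ZE mulrDl lerBrDl.
move=> /(sup_upper_bound supE); rewrite -/m; lra.
Qed.

End SelfAdjoint.

(** * Polynomials of an operator *)

Section PolynomialOperators.
Set Implicit Arguments.
Unset Strict Implicit.
Variables (R : realType) (H : completeNormedModType R[i]).
Implicit Types (x y z : H) (T S X Y Z : H -> H) (a c m e : R).
Implicit Types (p q : {poly R}) (P Q : {poly R[i]}).

(** Complex coefficients make the factorisation into linear factors available. *)
Definition cpoly_operator P T : H -> H :=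
  fun x => \sum_(k < size P) P`_k *: iter k T x.

Lemma cpoly_operator_widen n P T x : (size P <= n)%N ->
  cpoly_operator P T x = \sum_(k < n) P`_k *: iter k T x.
Proof.
move=> Pn; rewrite /cpoly_operator
  (big_ord_widen n (fun k => P`_k *: iter k T x) Pn).
rewrite big_mkcond /=; apply: eq_bigr => i _; case: ltnP => // iP.
by rewrite nth_default// scale0r.
Qed.

Lemma poly_operatorE p T : poly_operator p T = cpoly_operator
  (map_poly (real_complex R) p) T.
Proof.
apply/funext => x; rewrite /poly_operator fct_sumE
  (@cpoly_operator_widen (size p)).
  by apply: eq_bigr => i _; rewrite coef_map.
by rewrite size_map_poly.
Qed.

Lemma cpoly_operatorD P Q T :
  cpoly_operator (P + Q) T = cpoly_operator P T + cpoly_operator Q T.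
Proof.
apply/funext => x; rewrite fctE; pose n := maxn (size P) (size Q).
rewrite !(@cpoly_operator_widen n) ?leq_maxl ?leq_maxr ?size_polyD//.
by rewrite -big_split; apply: eq_bigr => i _; rewrite coefD scalerDl.
Qed.

Lemma cpoly_operatorZ (w : R[i]) P T : cpoly_operator (w *: P) T = w *:
  cpoly_operator P T.
Proof.
apply/funext => x; rewrite fctE (@cpoly_operator_widen (size P))
  ?size_scale_leq//.
by rewrite scaler_sumr; apply: eq_bigr => i _; rewrite coefZ scalerA.
Qed.

Lemma cpoly_operatorC (w : R[i]) T : cpoly_operator w%:P T = w *: idfun.
Proof.
apply/funext => x; rewrite fctE (@cpoly_operator_widen 1) ?size_polyC_leq1//.
by rewrite big_ord1 coefC.
Qed.

Lemma cpoly_operatorMX P T : cpoly_operator (P * 'X) T = cpoly_operator P T \o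
  T.
Proof.
apply/funext => x; rewrite /= (@cpoly_operator_widen (size P).+1); last first.
  by rewrite (leq_trans (size_polyMleq _ _))// size_polyX addn2.
rewrite big_ord_recl coefMX scale0r add0r; apply: eq_bigr => i _.
by rewrite coefMX /= -iterSr.
Qed.

Lemma cpoly_operator_comm P T : linear T -> cpoly_operator P T \o T = T \o
  cpoly_operator P T.
Proof.
move=> lT; apply/funext => x /=.
rewrite /cpoly_operator (big_morph T (linear_add lT) (linear0_op lT)).
by apply: eq_bigr => i _; rewrite (linear_scale lT) -iterSr iterS.
Qed.

Lemma cpoly_operatorM P Q T : linear T ->
  cpoly_operator (P * Q) T = cpoly_operator P T \o cpoly_operator Q T.
Proof.
move=> lT; elim/poly_ind: P => [|P w ih].
  rewrite mul0r -(scale0r 1) cpoly_operatorZ; apply/funext => x.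
  by rewrite !fctE /= !scale0r.
rewrite mulrDl -mulrA (mulrC 'X) mulrA !cpoly_operatorD !cpoly_operatorMX ih.
rewrite mul_polyC cpoly_operatorZ cpoly_operatorC; apply/funext => x.
rewrite !fctE /=; congr (cpoly_operator P T _ + _).
by have /(congr1 (@^~ x)) := cpoly_operator_comm Q lT.
Qed.

Lemma bounded_cpoly P T : bounded_operator T -> bounded_operator
  (cpoly_operator P T).
Proof.
move=> bT; elim/poly_ind: P => [|P w ih].
  by rewrite -(scale0r 1) cpoly_operatorZ scale0r; exact: bounded0.
rewrite cpoly_operatorD cpoly_operatorMX cpoly_operatorC; apply: boundedD.
  exact: bounded_comp.
by apply: boundedZ; exact: bounded_id.
Qed.

(** Over the complex numbers [P] splits, so [P(T)] is a nonzero multiple of a composition of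
    operators [T - w] with [w] a root. *)
Lemma cpoly_invertible P T : bounded_operator T -> P != 0 ->
    (forall w, root P w -> invertible_operator (T - w *: idfun)) ->
  invertible_operator (cpoly_operator P T).
Proof.
move=> bT P0 rP; have [r Pr] := closed_field_poly_normal P.
have lP : lead_coef P != 0 by rewrite lead_coef_eq0.
have {}rP w : w \in r -> invertible_operator (T - w *: idfun).
  by move=> wr; apply: rP; rewrite Pr rootZ// root_prod_XsubC.
rewrite Pr cpoly_operatorZ; apply: invertibleZ => //;
  first exact: bounded_cpoly.
elim: r {Pr} rP => [|w r ih] rP.
  by rewrite big_nil cpoly_operatorC scale1r; exact: invertible_id.
rewrite big_cons cpoly_operatorM; last exact: bounded_linear.
apply: invertible_comp; last by apply: ih => v vr; apply: rP;
  rewrite inE vr orbT.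
have := rP w (mem_head _ _); congr invertible_operator.
rewrite cpoly_operatorD -polyCN cpoly_operatorC scaleNr; congr (_ - _).
rewrite -['X]mul1r cpoly_operatorMX; apply/funext => x /=.
by rewrite cpoly_operatorC fctE scale1r.
Qed.

Lemma poly_operatorD p q T : poly_operator (p + q) T = poly_operator p T +
  poly_operator q T.
Proof. by rewrite !poly_operatorE rmorphD cpoly_operatorD. Qed.

Lemma poly_operatorC a T : poly_operator a%:P T = a%:C *: idfun.
Proof. by rewrite poly_operatorE map_polyC cpoly_operatorC. Qed.

Lemma poly_operatorM p q T : linear T ->
  poly_operator (p * q) T = poly_operator p T \o poly_operator q T.
Proof. by move=> lT; rewrite !poly_operatorE rmorphM cpoly_operatorM. Qed.

Lemma poly_operatorZ a p T : poly_operator (a *: p) T = a%:C *: poly_operator p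
  T.
Proof. by rewrite !poly_operatorE map_polyZ cpoly_operatorZ. Qed.

Lemma poly_operatorB p q T : poly_operator (p - q) T = poly_operator p T -
  poly_operator q T.
Proof.
by rewrite poly_operatorD -scaleN1r poly_operatorZ rmorphN rmorph1 scaleN1r.
Qed.

Lemma poly_operatorX T : poly_operator 'X T = T.
Proof.
rewrite poly_operatorE map_polyX -['X]mul1r cpoly_operatorMX;
  apply/funext => x /=.
by rewrite cpoly_operatorC fctE scale1r.
Qed.

Lemma bounded_poly p T : bounded_operator T -> bounded_operator
  (poly_operator p T).
Proof. by rewrite poly_operatorE; exact: bounded_cpoly. Qed.

End PolynomialOperators.

(** * From inequalities on the spectrum to inequalities between operators *)

Section SpectralPositivity.
Set Implicit Arguments.
Unset Strict Implicit.
Variables (R : realType) (H : completeNormedModType R[i]).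
Variables (ip : {dot H for Num.conj}) (ip_norm : norm_of_inner_product ip).
Implicit Types (x y z : H) (T S X Y Z : H -> H) (a c m e : R) (p q : {poly R}).
Local Notation rdot := (rdot ip).
Local Notation self_adjoint := (self_adjoint ip).

Lemma self_adjoint_poly p X : self_adjoint X -> self_adjoint
  (poly_operator p X).
Proof.
move=> sX; have lX := bounded_linear sX.1; elim/poly_ind: p => [|p c ih].
  by rewrite -polyC0 poly_operatorC; apply: self_adjointZ;
    exact: self_adjoint_id.
rewrite poly_operatorD poly_operatorC; apply: self_adjointD; last first.
  by apply: self_adjointZ; exact: self_adjoint_id.
rewrite poly_operatorM// poly_operatorX; apply: self_adjoint_comp => // x.
by rewrite poly_operatorE cpoly_operator_comm.
Qed.

Lemma not_spectrum X s : ~ real_spectrum X s -> invertible_operator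
  (X - s%:C *: idfun).
Proof. by move=> /contrapT. Qed.

(** An empty spectrum makes [X - (M + 1)] positive by [psd_of_resolvent], although
    [<X x, x> <= M |x|^2]; only [x = 0] allows both. *)
Lemma real_spectrum_nonempty X : self_adjoint X ->
  (forall s, ~ real_spectrum X s) -> forall x, x = 0.
Proof.
move=> sX X0 x; have [M M0 hM] := rdot_bounded ip_norm sX.1.
have : psd ip (X - (M + 1)%:C *: idfun).
  apply: psd_of_resolvent => //.
    by apply: self_adjointB => //; apply: self_adjointZ; exact: self_adjoint_id.
  move=> l l0; rewrite addrAC -addrA -opprB -scalerBl -rmorphB.
  exact/not_spectrum/X0.
move=> /(_ x); rewrite !fctE rdotBl rdotZl (rdotxx ip_norm) => h.
have := le_trans (ler_norm _) (hM x) => h2.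
apply: rnorm_eq0; apply/eqP; rewrite -sqrf_eq0; apply/eqP.
have := rnorm_ge0 x => h3; have : 0 <= rnorm x ^+ 2 by rewrite exprn_ge0.
move: (rnorm x ^+ 2) h h2 => t h h2 t0; lra.
Qed.

(** A root of [p + l] is nonreal or a real point outside the spectrum, because [p + l > 0] on the
    spectrum; so every linear factor is invertible. *)
Lemma psd_poly p X : self_adjoint X ->
  (forall s, real_spectrum X s -> 0 <= p.[s]) ->
  psd ip (poly_operator p X).
Proof.
move=> sX hp; apply: psd_of_resolvent => //; first exact: self_adjoint_poly.
move=> l l0; rewrite -(poly_operatorC _ X) -poly_operatorD.
have [pl0|pl0] := eqVneq (p + l%:P) 0.
  (* p = - l < 0, so the spectrum is empty, which forces H = 0 *)
  have H0 : forall x : H, x = 0.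
    apply: (real_spectrum_nonempty sX) => s Xs; have := hp s Xs.
    move/eqP: pl0; rewrite addr_eq0 => /eqP ->.
    by rewrite -polyCN hornerC oppr_ge0 leNgt l0.
  by exists idfun; split=> [|x|x]; rewrite ?(H0 (_ x))// ?(H0 x);
    first exact: bounded_id.
rewrite poly_operatorE; apply: cpoly_invertible; first exact: sX.1.
  by rewrite map_poly_eq0.
move=> w rw; have [w0|w0] := eqVneq (complex.Im w) 0;
  last exact: nonreal_invertible ip_norm _ _ sX w0.
have we : w = (complex.Re w)%:C.
  by case: w w0 {rw} => a b /= ->.
rewrite we; apply: not_spectrum => Xs; have := hp _ Xs.
move: rw; rewrite we /root horner_map => /eqP []; rewrite hornerD hornerC => pl.
by move/eqP: pl; rewrite addr_eq0 => /eqP ->; rewrite oppr_ge0 leNgt l0.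
Qed.

(** Positivity of [e^2 - p^2] at [X] reads [|p(X) x|^2 <= e^2 |x|^2], since [p(X)] is
    self-adjoint. *)
Lemma rnorm_poly_le p X e : self_adjoint X -> 0 <= e ->
    (forall s, real_spectrum X s -> `|p.[s]| <= e) ->
  forall x, rnorm (poly_operator p X x) <= e * rnorm x.
Proof.
move=> sX e0 hp x; have lX := bounded_linear sX.1.
rewrite -ler_sqr ?nnegrE ?mulr_ge0 ?rnorm_ge0// exprMn.
have : psd ip (poly_operator ((e ^+ 2)%:P - p * p) X).
  apply: psd_poly => // s Xs;
    rewrite hornerD hornerN hornerC hornerM subr_ge0 -expr2.
  by rewrite -(real_normK (num_real p.[s])) ler_sqr ?nnegrE// hp.
move=> /(_ x); rewrite poly_operatorB poly_operatorC poly_operatorM// !fctE /=.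
have /self_adjointP[_ hX] := self_adjoint_poly p sX.
by rewrite rdotBl rdotZl hX !(rdotxx ip_norm) subr_ge0.
Qed.

(** For [s < m] the operator [X - s] is coercive, and for [s > M] the operator [s - X] is. *)
Lemma real_spectrum_bound X m M : self_adjoint X -> coercive ip m X ->
    (forall x, rdot (X x) x <= M * rnorm x ^+ 2) ->
  forall s, real_spectrum X s -> m <= s <= M.
Proof.
move=> sX cX MX s Xs; apply/andP; split; rewrite leNgt; apply/negP => sm;
  apply: Xs.
  apply: (@coercive_invertible _ _ ip ip_norm (m - s));
    first by rewrite subr_gt0.
    by apply: self_adjointB => //; apply: self_adjointZ; exact: self_adjoint_id.
  by move=> x; rewrite !fctE rdotBl rdotZl (rdotxx ip_norm) mulrBl lerD2r.
rewrite -opprB -scaleN1r; apply: invertibleZ;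
  first by rewrite oppr_eq0 oner_eq0.
  by apply: boundedB; [apply: boundedZ; exact: bounded_id|exact: sX.1].
apply: (@coercive_invertible _ _ ip ip_norm (s - M)); first by rewrite subr_gt0.
  by apply: self_adjointB => //; apply: self_adjointZ; exact: self_adjoint_id.
by move=> x; rewrite !fctE rdotBl rdotZl (rdotxx ip_norm) mulrBl lerD2l lerN2.
Qed.

End SpectralPositivity.

(** * Functional calculus *)

Section FunctionalCalculus.
Set Implicit Arguments.
Unset Strict Implicit.
Variables (R : realType) (H : completeNormedModType R[i]).
Variables (ip : {dot H for Num.conj}) (ip_norm : norm_of_inner_product ip).
Implicit Types (x y z : H) (T S X Y Z : H -> H) (a c m e : R) (p q : {poly R}).
Implicit Types (f g : R -> R) (E : set R).
Local Notation rdot := (rdot ip).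
Local Notation self_adjoint := (self_adjoint ip).

Definition poly_approximable E f :=
  forall e, 0 < e -> exists p, forall s, E s -> `|p.[s] - f s| <= e.

(** An epsilon form of [is_functional_calculus] that spares the handling of sequences; one
    polynomial serves both estimates. *)
Definition approx_calculus f X T := bounded_operator T /\
  forall e, 0 < e -> exists p,
    (forall s, real_spectrum X s -> `|p.[s] - f s| <= e) /\
    forall x, rnorm (poly_operator p X x - T x) <= e * rnorm x.

Lemma uniform_cvgP E f (u : nat -> R -> R) :
  {uniform E, u @ \oo --> f} <->
  forall e, 0 < e -> \forall k \near \oo, forall s, E s -> `|u k s - f s| <= e.
Proof.
split=> [cu e e0|cu].
  have : nbhs (f : {uniform` E -> R})
    [set h | forall s, E s -> `|h s - f s| <= e].
    apply/uniform_nbhs; exists [set xy | ball xy.1 e xy.2]; split.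
      exact: entourage_ball (PosNum e0).
    by move=> h hf s Es; have := hf s Es;
      rewrite /= -ball_normE /= distrC => /ltW.
  by move=> /cu.
move=> P /uniform_nbhs[V [/= entV sV]].
move: entV; rewrite -entourage_ballE => -[e /= e0 eV].
have e20 : 0 < e / 2 by rewrite divr_gt0.
have := cu _ e20; apply: filterS => k hk; apply: sV => s Es; apply: eV => /=.
rewrite -ball_normE /= distrC (le_lt_trans (hk s Es))//.
by rewrite ltr_pdivrMr// ltr_pMr// ltr1n.
Qed.

Lemma approx_calculusP f X T : is_functional_calculus f X T <-> approx_calculus
  f X T.
Proof.
split=> -[bT].
  move=> [p [/uniform_cvgP fp pT]]; split=> // e e0.
  have [N1 _ h1] := fp e e0; have [N2 _ h2] := pT e e0.
  exists (p (maxn N1 N2)); split=> [s|x]; first exact: (h1 _ (leq_maxl _ _)).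
  by have := h2 _ (leq_maxr N1 N2) x; rewrite /= !rnormE -rmorphM lecR.
move=> h; split=> //.
have /choice[p hp] : forall k : nat, exists q,
    (forall s, real_spectrum X s -> `|q.[s] - f s| <= k.+1%:R^-1) /\
    forall x, rnorm (poly_operator q X x - T x) <= k.+1%:R^-1 * rnorm x.
  by move=> k; apply: h; rewrite invr_gt0.
have near_le e : 0 < e -> \forall k \near \oo, k.+1%:R^-1 <= e.
  move=> e0; have := near_infty_natSinv_lt (PosNum e0); apply: filterS => k.
  exact: ltW.
exists p; split.
  apply/uniform_cvgP => e /near_le; apply: filterS => k ke s Xs.
  exact: le_trans ((hp k).1 s Xs) ke.
move=> e /near_le; apply: filterS => k ke x; rewrite !rnormE -rmorphM lecR.
by apply: le_trans ((hp k).2 x) _; rewrite ler_wpM2r ?rnorm_ge0.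
Qed.

Lemma calculus_poly p X : bounded_operator X ->
  approx_calculus (horner p) X (poly_operator p X).
Proof.
move=> bX; split; first exact: bounded_poly.
move=> e e0; exists p; split=> [s _|x].
  by rewrite subrr normr0 ltW.
by rewrite subrr {1}/rnorm normr0 mulr_ge0 ?rnorm_ge0 ?ltW.
Qed.

Lemma calculusD f g X T S : approx_calculus f X T -> approx_calculus g X S ->
  approx_calculus (fun s => f s + g s) X (T + S).
Proof.
move=> [bT hT] [bS hS]; split; first exact: boundedD.
move=> e e0; have e20 : 0 < e / 2 by rewrite divr_gt0.
have [[p [pf pT]] [q [qg qS]]] := (hT _ e20, hS _ e20).
exists (p + q); split=> [s Xs|x].
  rewrite hornerD opprD addrACA (splitr e).
  by rewrite (le_trans (ler_normD _ _))// lerD ?pf ?qg.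
rewrite poly_operatorD !fctE opprD addrACA (splitr e) mulrDl.
by rewrite (le_trans (rnorm_triangle _ _))// lerD.
Qed.

Lemma calculusZ a f X T : approx_calculus f X T ->
  approx_calculus (fun s => a * f s) X (a%:C *: T).
Proof.
move=> [bT hT]; split; first exact: boundedZ.
move=> e e0; have a0 : 0 < `|a| + 1 by rewrite ltr_wpDl.
have e20 : 0 < e / (`|a| + 1) by rewrite divr_gt0.
have ae : `|a| * (e / (`|a| + 1)) <= e.
  by rewrite mulrCA ger_pMr// ler_pdivrMr// mul1r lerDl.
have [p [pf pT]] := hT _ e20; exists (a *: p); split=> [s Xs|x].
  by rewrite hornerZ -mulrBr normrM (le_trans _ ae)// ler_wpM2l// pf.
rewrite poly_operatorZ !fctE -scalerBr rnormZr.
apply: le_trans (ler_wpM2l (normr_ge0 _) (pT x)) _.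
by rewrite mulrA ler_wpM2r ?rnorm_ge0.
Qed.

Lemma calculus_sum (n : nat) (f : 'I_n -> R -> R) X (T : 'I_n -> H -> H) :
  (forall i, approx_calculus (f i) X (T i)) ->
  approx_calculus (fun s => \sum_(i < n) f i s) X (\sum_(i < n) T i).
Proof.
move=> hf; elim: n => [|n ih] in f T hf *.
  split; first by rewrite big_ord0; exact: bounded0.
  move=> e e0; exists 0; split=> [s _|x].
    by rewrite horner0 big_ord0 subrr normr0 ltW.
  rewrite big_ord0 -polyC0 poly_operatorC fctE scale0r subrr {1}/rnorm normr0.
  by rewrite mulr_ge0 ?rnorm_ge0 ?ltW.
rewrite big_ord_recr /=.
have -> : (fun s => \sum_(i < n.+1) f i s) =
          (fun s => \sum_(i < n) f (widen_ord (leqnSn n) i) s + f ord_max s).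
  by apply/funext => s; rewrite big_ord_recr.
by apply: calculusD => //; apply: ih => i; exact: hf.
Qed.

(** Multiplying the approximants by ['X] costs a factor [M] on the spectrum and a factor [L] in
    operator norm; [M + L] covers both. *)
Lemma calculusX f X T : self_adjoint X -> approx_calculus f X T ->
  approx_calculus (fun s => s * f s) X (X \o T).
Proof.
move=> sX [bT hT]; have lX := bounded_linear sX.1.
split; first by apply: bounded_comp => //; exact: sX.1.
move=> e e0; have [_ [L L0 hL]] := (bounded_operatorP _).1 sX.1.
have [M M0 hM] := rdot_bounded ip_norm sX.1.
have Xs_le s : real_spectrum X s -> `|s| <= M.
  rewrite ler_norml; apply: (real_spectrum_bound ip_norm) => // x.
    by have := hM x; rewrite ler_norml mulNr => /andP[].
  exact: le_trans (ler_norm _) (hM x).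
have ML0 : 0 < M + L by rewrite ltr_wpDr.
have e20 : 0 < e / (M + L) by rewrite divr_gt0.
have ae c : c <= M + L -> c * (e / (M + L)) <= e.
  by move=> ?; rewrite mulrCA ger_pMr// ler_pdivrMr// mul1r.
have [p [pf pT]] := hT _ e20; exists ('X * p); split=> [s Xs|x].
  rewrite hornerM hornerX -mulrBr normrM.
  apply: le_trans (ae M _); last by rewrite lerDl.
  by rewrite ler_pM// ?Xs_le ?pf.
rewrite poly_operatorM// poly_operatorX /= -linear_sub// (le_trans (hL _))//.
apply: le_trans (ler_wpM2l L0 (pT x)) _;
  rewrite mulrA ler_wpM2r ?rnorm_ge0// ae//.
by rewrite lerDr ltW.
Qed.

(** Approximants of [T] and [S] differ by at most [2 e] on the spectrum, hence in operator norm; two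
    further errors [e] give the constant 4. *)
Lemma calculus_unique f g X T S : self_adjoint X ->
    (forall s, real_spectrum X s -> f s = g s) ->
  approx_calculus f X T -> approx_calculus g X S -> T = S.
Proof.
move=> sX fg [bT hT] [bS hS]; apply/funext => x.
apply: (@rnorm_harmonic_eq _ _ _ _ (4 * rnorm x)) => k.
set e : R := k.+1%:R^-1; have e0 : 0 < e by rewrite invr_gt0.
have [[p [pf pT]] [q [qg qS]]] := (hT _ e0, hS _ e0).
have e20 : 0 <= e + e by rewrite addr_ge0 ?ltW.
have := @rnorm_poly_le _ _ _ ip_norm (p - q) X (e + e) sX e20.
rewrite poly_operatorB => /(_ _ x).
have pq s : real_spectrum X s -> `|(p - q).[s]| <= e + e.
  move=> Xs; rewrite hornerD hornerN -(subrKA (f s)).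
  rewrite (le_trans (ler_normD _ _))// lerD ?pf//.
  by rewrite distrC (fg _ Xs) qg.
move=> /(_ pq); rewrite fctE => h.
apply: le_trans (rnorm_triangle3 (poly_operator p X x) _ _) _.
have := rnorm_triangle3 (poly_operator q X x) (poly_operator p X x) (S x).
have := pT x; have := qS x; rewrite (rnormB (T x)).
have := rnorm_ge0 x; move: h.
set t1 := rnorm _; set t2 := rnorm (_ - S x); set t3 := rnorm (_ - T x).
set t4 := rnorm (_ - S x).
move: t1 t2 t3 t4 (rnorm x) => t1 t2 t3 t4 t h t0 h1 h2 h3.
by rewrite mulrDl in h; lra.
Qed.

(** Polynomials in [X] are self-adjoint, and this relation passes to the norm limit. *)
Lemma calculus_self_adjoint f X T : self_adjoint X -> approx_calculus f X T ->
  self_adjoint T.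
Proof.
move=> sX [bT hT]; apply/self_adjointP; split=> // x y.
have close e : 0 < e -> `|rdot (T x) y - rdot x (T y)| <= e *
  (2 * (rnorm x * rnorm y)).
  move=> e0; have [p [_ pT]] := hT _ e0.
  have /self_adjointP[_ hp] := self_adjoint_poly p sX.
  have -> : rdot (T x) y - rdot x (T y) =
      rdot (poly_operator p X y - T y) x - rdot (poly_operator p X x - T x) y.
    by rewrite !rdotBl (hp y) (rdotC ip y) (rdotC ip (T y)); ring.
  have bd u v : `|rdot (poly_operator p X u - T u) v| <= e *
    (rnorm u * rnorm v).
    have le1 w : rdot w v <= rnorm w * rnorm v := rdot_le ip_norm w v.
    have le2 := ler_wpM2r (rnorm_ge0 v) (pT u).
    rewrite mulrA ler_norml lerNl -rdotNl; apply/andP; split.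
      by rewrite (le_trans (le1 _))// /rnorm normrN.
    exact: le_trans (le1 _) le2.
  apply: le_trans (ler_normB _ _) _; have := bd x y; have := bd y x.
  rewrite (mulrC (rnorm y)); move: `|_| `|_| => u v; lra.
apply/eqP; rewrite -subr_eq0 -normr_le0; apply/eqP.
have /le_harmonic0 : forall k : nat, `|rdot (T x) y - rdot x (T y)| <=
    k.+1%:R^-1 * (2 * (rnorm x * rnorm y)) by move=> k; apply: close;
      rewrite invr_gt0.
by move=> h; apply/eqP.
Qed.

(** The shifted approximant [p + e] is nonnegative on the spectrum; the shift and the norm error
    each cost [e |x|^2]. *)
Lemma calculus_psd f X T : self_adjoint X ->
  (forall s, real_spectrum X s -> 0 <= f s) ->
  approx_calculus f X T -> psd ip T.
Proof.
move=> sX f0 [bT hT] x; rewrite -oppr_le0.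
apply: (@le_harmonic0 _ _ (2 * rnorm x ^+ 2)) => k.
set e : R := k.+1%:R^-1; have e0 : 0 < e by rewrite invr_gt0.
have [p [pf pT]] := hT _ e0.
have : psd ip (poly_operator (p + e%:P) X).
  apply: psd_poly => // s Xs; rewrite hornerD hornerC.
  by have := pf s Xs; have := f0 s Xs; rewrite ler_norml => h /andP[]; lra.
move=> /(_ x); rewrite poly_operatorD poly_operatorC fctE rdotDl rdotZl
  (rdotxx ip_norm).
have := rdot_le ip_norm (poly_operator p X x - T x) x; rewrite rdotBl => h1.
have := ler_wpM2r (rnorm_ge0 x) (pT x); rewrite -mulrA -expr2 => h2.
by move: h1 h2; set u := rnorm _ * _; move: u (rnorm x ^+ 2) => u v; lra.
Qed.

(** [rnorm_poly_le] carries the uniform Cauchy estimate of the approximants over to the operators,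
    and completeness gives a limit at each vector. *)
Lemma calculus_exists f X : self_adjoint X -> poly_approximable
  (real_spectrum X) f ->
  exists T, approx_calculus f X T.
Proof.
move=> sX hf; have lX := bounded_linear sX.1.
have /choice[p hp] : forall k : nat, exists q,
    (forall s, real_spectrum X s -> `|q.[s] - f s| <= k.+1%:R^-1).
  by move=> k; apply: hf; rewrite invr_gt0.
have pkl (k l : nat) x : rnorm
  (poly_operator (p k) X x - poly_operator (p l) X x) <=
    (k.+1%:R^-1 + l.+1%:R^-1) * rnorm x.
  have e0 : 0 <= k.+1%:R^-1 + l.+1%:R^-1 :> R by rewrite addr_ge0 ?invr_ge0.
  have := @rnorm_poly_le _ _ _ ip_norm (p k - p l) X _ sX e0.
  rewrite poly_operatorB => /(_ _ x); apply=> s Xs.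
  rewrite hornerD hornerN -(subrKA (f s)) (le_trans (ler_normD _ _))// lerD
    ?hp//.
  by rewrite distrC hp.
have /choice[T hT] x : exists y, forall k : nat,
    rnorm (poly_operator (p k) X x - y) <= k.+1%:R^-1 * rnorm x.
  by apply: cauchy_limit; rewrite ?rnorm_ge0.
have lp k : linear (poly_operator (p k) X).
  by apply: bounded_linear; apply: bounded_poly; exact: sX.1.
exists T; split; last first.
  move=> e e0; have [k _ /(_ k (leqnn k)) /= hk] := near_infty_natSinv_lt
    (PosNum e0).
  exists (p k); split=> [s Xs|x]; first exact: le_trans (hp k s Xs) (ltW hk).
  by apply: le_trans (hT x k) _; rewrite ler_wpM2r ?rnorm_ge0// ltW.
have [_ [M M0 hM]] := (bounded_operatorP _).1 (bounded_poly (p 0) sX.1).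
apply/bounded_operatorP; split=> [w x y|].
  apply: (@rnorm_harmonic_eq _ _ _ _
    (rnorm (w *: x + y) + (complex.Re `|w| * rnorm x + rnorm y))) => k.
  apply: le_trans (rnorm_triangle3 (poly_operator (p k) X (w *: x + y)) _ _) _.
  rewrite mulrDr lerD ?(rnormB (T _))//.
  rewrite lp opprD addrACA -scalerBr (le_trans (rnorm_triangle _ _))// mulrDr
    lerD//.
  rewrite rnormZ mulrCA ler_wpM2l//.
  by rewrite -ler0c RRe_real ?ger0_real.
(* The approximant of index 0 has error at most [|x|]. *)
exists (M + 1); first by rewrite addr_ge0.
move=> x; rewrite -[T x](subrK (poly_operator (p 0) X x)) addrC mulrDl mul1r.
rewrite (le_trans (rnorm_triangle _ _))// lerD// rnormB (le_trans (hT x 0%N))//.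
by rewrite invr1 mul1r.
Qed.

(** Approximability yields a witness, so [xget] does not fall back on its default value. *)
Lemma functional_calculusP f X : self_adjoint X ->
    poly_approximable (real_spectrum X) f ->
  approx_calculus f X (functional_calculus f X).
Proof.
move=> sX /(calculus_exists sX)[T /approx_calculusP hT]; apply/approx_calculusP.
exact: (xgetPex 0 (ex_intro _ T hT)).
Qed.

End FunctionalCalculus.

(** * Polynomial approximation of the logarithm *)

Section ScalarApproximation.
Set Implicit Arguments.
Unset Strict Implicit.
Variable R : realType.
Implicit Types (s a b c e m M : R) (f g : R -> R) (E : set R).

Lemma approximable_cst E a : poly_approximable E (cst a).
Proof. by move=> e e0; exists a%:P => s _;
  rewrite hornerC subrr normr0 ltW. Qed.

Lemma approximableD E f g : poly_approximable E f -> poly_approximable E g ->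
  poly_approximable E (fun s => f s + g s).
Proof.
move=> hf hg e e0; have e20 : 0 < e / 2 by rewrite divr_gt0.
have [[p pf] [q qg]] := (hf _ e20, hg _ e20); exists (p + q) => s Es.
by rewrite hornerD opprD addrACA (splitr e) (le_trans (ler_normD _ _))// lerD
  ?pf ?qg.
Qed.

Lemma approximableZ E a f : poly_approximable E f -> poly_approximable E
  (fun s => a * f s).
Proof.
move=> hf e e0; have a0 : 0 < `|a| + 1 by rewrite ltr_wpDl.
have e20 : 0 < e / (`|a| + 1) by rewrite divr_gt0.
have ae : `|a| * (e / (`|a| + 1)) <= e.
  by rewrite mulrCA ger_pMr// ler_pdivrMr// mul1r lerDl.
have [p pf] := hf _ e20; exists (a *: p) => s Es.
by rewrite hornerZ -mulrBr normrM (le_trans _ ae)// ler_wpM2l// pf.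
Qed.

Lemma approximable_sum E (n : nat) (f : 'I_n -> R -> R) :
  (forall i, poly_approximable E (f i)) ->
  poly_approximable E (fun s => \sum_(i < n) f i s).
Proof.
move=> hf; have : forall r : seq 'I_n, poly_approximable E
  (fun s => \sum_(i <- r) f i s).
  elim=> [|i r ih] e e0.
    by have [p hp] := @approximable_cst E 0 e e0; exists p => s;
      rewrite big_nil; exact: hp.
  have [p hp] := approximableD (hf i) ih e0; exists p => s.
  by rewrite big_cons; exact: hp.
exact.
Qed.

(** Geometric series: for [w = a + b s] in [[c, K]], the ratio [q = 1 - w / K] lies in
    [[0, 1 - c / K]], and [1 / w] is the sum of the [q ^ i / K]. *)
Lemma approximable_inv E a b c K : 0 < c -> c <= K ->
    (forall s, E s -> c <= a + b * s <= K) ->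
  poly_approximable E (fun s => (a + b * s)^-1).
Proof.
move=> c0 cK hE e e0; have K0 : 0 < K := lt_le_trans c0 cK.
have c1 : c / K <= 1 by rewrite ler_pdivrMr// mul1r.
have th01 : 0 <= 1 - c / K < 1 by rewrite subr_ge0 c1 ltrBlDr ltrDl divr_gt0.
pose th := 1 - c / K; have [th0 th1] := andP th01.
(* After division by [w >= c] the remainder [th ^ n] has to be at most [c e]; the factor [1 - th]
   comes from [geometric_harmonic]. *)
have ce0 : 0 < c * e * (1 - th) by rewrite !mulr_gt0// subr_gt0.
have [n _ /(_ n (leqnn n)) /= hn] := near_infty_natSinv_lt (PosNum ce0).
pose q : {poly R} := 1 - K^-1 *: (a%:P + b *: 'X).
exists (K^-1 *: \sum_(i < n) q ^+ i) => s Es; have /andP[cw wK] := hE s Es.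
set w := a + b * s in cw wK *.
have w0 : 0 < w := lt_le_trans c0 cw.
have qs : q.[s] = 1 - w / K by rewrite !hornerE mulrC.
have qs0 : 0 <= q.[s] by rewrite qs subr_ge0 ler_pdivrMr// mul1r.
have qsth : q.[s] <= th by rewrite qs lerD2l lerN2 ler_pM2r ?invr_gt0.
have -> : (K^-1 *: \sum_(i < n) q ^+ i).[s] - w^-1 = - (q.[s] ^+ n / w).
  rewrite hornerZ horner_sum; under eq_bigr do rewrite horner_exp.
  have := subrX1 q.[s] n; rewrite {2}qs => h.
  have -> : q.[s] ^+ n = 1 - w / K * \sum_(i < n) q.[s] ^+ i.
    by rewrite -[LHS](subrK 1) h; ring.
  by move: (\sum_(i < n) _) => t; field; rewrite !gt_eqF.
rewrite normrN ger0_norm; last by rewrite divr_ge0 ?exprn_ge0// ltW.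
rewrite ler_pdivrMr//; apply: (@le_trans _ _ (th ^+ n));
  first by rewrite lerXn2r ?nnegrE.
apply: (le_trans (geometric_harmonic n th01)).
rewrite ler_pdivrMr ?subr_gt0//; apply: le_trans (ltW hn) _.
by rewrite ler_wpM2r ?subr_ge0 ?(ltW th1)// mulrC ler_wpM2l// ltW.
Qed.

(** Right endpoints of the [N + 1] equal pieces of the unit interval; they avoid 0, so division by a
    node is legitimate. *)
Definition node (N k : nat) : R := k.+1%:R / N.+1%:R.

Lemma node_gt0 N k : 0 < node N k. Proof. by rewrite divr_gt0. Qed.

Lemma node_le1 N (k : 'I_N.+1) : node N k <= 1.
Proof. by rewrite ler_pdivrMr// mul1r ler_nat ltn_ord. Qed.

(** This keeps [1 - a + a s] away from 0 uniformly in [a]. *)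
Lemma convex_ge_min a s : 0 <= a <= 1 -> Num.min 1 s <= 1 - a + a * s.
Proof.
move=> /andP[a0 a1].
have h1 : (1 - a) * Num.min 1 s <= (1 - a) * 1.
  by rewrite ler_wpM2l ?subr_ge0// ge_min lexx.
have h2 : a * Num.min 1 s <= a * s by rewrite ler_wpM2l// ge_min lexx orbT.
by move: h1 h2; move: (Num.min 1 s) => u; lra.
Qed.

Lemma ln_le_sub1 s : 0 < s -> ln s <= s - 1.
Proof. by move=> s0; rewrite -{1}(subrK 1 s) addrC le_ln1Dx// ltrBrDr addNr.
  Qed.

(* Lower and upper Riemann sums of ln s = int_0^1 (s - 1) / (1 - a + a s) da. *)
Lemma ln_riemann N s : 0 < s ->
  let r := \sum_(k < N.+1) N.+1%:R^-1 *
    ((s - 1) / (1 - node N k + node N k * s)) in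
  r <= ln s <= r + N.+1%:R^-1 * ((s - 1) ^+ 2 / s).
Proof.
(* [w k] is the value of [1 - a + a s] at [a = k / (N + 1)]: an arithmetic progression from 1 to
   [s], along which [ln] telescopes. *)
move=> s0 /=; pose d := (s - 1) / N.+1%:R; pose w (k : nat) := 1 + k%:R * d.
have w_gt0 (k : nat) : (k <= N.+1)%N -> 0 < w k.
  move=> kN; have -> : w k = 1 - k%:R / N.+1%:R + k%:R / N.+1%:R * s.
    by rewrite /w /d; ring.
  have k1 : k%:R / N.+1%:R <= 1 :> R by rewrite ler_pdivrMr// mul1r ler_nat.
  have k0 : 0 <= k%:R / N.+1%:R :> R by rewrite divr_ge0.
  apply: lt_le_trans (convex_ge_min _ _); last by rewrite k0.
  by rewrite lt_min ltr01.
have wS k : w k.+1 = w k + d by rewrite /w -natr1; ring.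
(* Both bounds are [ln x <= x - 1], for the ratio of consecutive values and for its inverse. *)
have step k : (k < N.+1)%N -> d / w k.+1 <= ln (w k.+1) - ln (w k) <= d / w k.
  move=> kN; have [a0 b0] := (w_gt0 _ kN, w_gt0 _ (ltnW kN)).
  have h1 := ln_le_sub1 (divr_gt0 a0 b0);
    have h2 := ln_le_sub1 (divr_gt0 b0 a0).
  rewrite ln_div// in h1; rewrite ln_div// in h2.
  have e1 : d / w k.+1 = 1 - w k / w k.+1 by rewrite wS in a0 *; field;
    rewrite gt_eqF.
  have e2 : d / w k = w k.+1 / w k - 1 by rewrite wS; field; rewrite gt_eqF.
  by rewrite e1 e2 h1 andbT; move: h2; lra.
(* The left and right sums differ by the telescoping [d / w 0 - d / w n], where [w 0 = 1]. *)
have main (n : nat) : (n <= N.+1)%N ->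
    \sum_(k < n) d / w k.+1 <= ln (w n) <= \sum_(k < n) d / w k.+1 + d - d / w
      n.
  elim: n => [_|n ih nN].
    by rewrite big_ord0 add0r /w mul0r addr0 ln1 divr1 subrr lexx.
  rewrite big_ord_recr /=; have := ih (ltnW nN); have := step n nN.
  by move=> /andP[? ?] /andP[? ?]; apply/andP; split; lra.
have wN : w N.+1 = s by rewrite /w /d mulrC divfK ?pnatr_eq0// addrC subrK.
have := main N.+1 (leqnn _); rewrite wN.
have -> : \sum_(k < N.+1) N.+1%:R^-1 * ((s - 1) / (1 - node N k + node N k * s))
  =
    \sum_(k < N.+1) d / w k.+1.
  apply: eq_bigr => k _; rewrite mulrCA mulrA; congr (_ / _).
  by rewrite /w /d /node; ring.
have -> : N.+1%:R^-1 * ((s - 1) ^+ 2 / s) = d - d / s.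
  by rewrite /d; field; rewrite nat1r pnatr_eq0 gt_eqF.
by rewrite addrA.
Qed.

(** The right Riemann sums are combinations of constants and reciprocals of affine functions, to
    which [approximable_inv] applies; [ln_riemann] controls their distance to [ln]. *)
Lemma approximable_ln E m M : 0 < m -> (forall s, E s -> m <= s <= M) ->
  poly_approximable E (@ln R).
Proof.
move=> m0 hE e e0.
have [M0|M0] := ltP M m.
  by exists 0 => s /hE/andP[ms sM]; have := le_trans ms sM; rewrite leNgt M0.
(* [C] bounds [(s - 1)^2 / s] for [s] between [m] and [M]. *)
pose C := (1 + M) ^+ 2 / m + 1.
have C0 : 0 < C by rewrite ltr_wpDl// divr_ge0 ?exprn_ge0 ?(ltW m0)// addr_ge0//
  (le_trans (ltW m0)).
have e20 : 0 < e / 2 / C by rewrite !divr_gt0.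
have [N _ /(_ N (leqnn N)) /= hN] := near_infty_natSinv_lt (PosNum e20).
(* With [a] the node and [w = 1 - a + a s], the summand is rewritten by
   [(s - 1) / w = (1 - 1 / w) / a]. *)
have : poly_approximable E (fun s => \sum_(k < N.+1)
    N.+1%:R^-1 * ((node N k)^-1 * (1 + -1 * (1 - node N k + node N k * s)^-1))).
  apply: approximable_sum => k; do 2 apply: approximableZ.
  apply: approximableD; first exact: approximable_cst.
  have k01 : 0 <= node N k <= 1 by rewrite ltW ?node_gt0 ?node_le1.
  have c0 : 0 < Num.min 1 m by rewrite lt_min ltr01.
  apply: approximableZ; apply:
    (@approximable_inv _ _ _ (Num.min 1 m) (1 + M)) => //.
    by rewrite ge_min; apply/orP; left; rewrite lerDl (le_trans (ltW m0)).
  move=> s /hE/andP[ms sM]; apply/andP; split.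
    apply: le_trans (convex_ge_min _ k01).
    by rewrite le_min ge_min lexx /= ge_min ms orbT.
  have [a0 a1] := andP k01; apply: lerD; first by rewrite gerBl.
  by rewrite (le_trans _ sM)// ger_pMl// (lt_le_trans m0).
have e2 : 0 < e / 2 by rewrite divr_gt0.
move=> /(_ _ e2)[p hp]; exists p => s Es; have := hp s Es.
have /andP[ms sM] := hE s Es; have s0 := lt_le_trans m0 ms.
set r := \sum_(k < _) _; move=> h.
have -> : p.[s] - ln s = (p.[s] - r) + (r - ln s) by ring.
rewrite (splitr e) (le_trans (ler_normD _ _))// lerD//.
have : r <= ln s <= r + N.+1%:R^-1 * ((s - 1) ^+ 2 / s).
  have -> : r = \sum_(k < N.+1) N.+1%:R^-1 *
    ((s - 1) / (1 - node N k + node N k * s)).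
    apply: eq_bigr => k _; congr (_ * _).
    have k0 := node_gt0 N k.
    have k01 : 0 <= node N k <= 1 by rewrite ltW ?node_gt0 ?node_le1.
    have : 0 < 1 - node N k + node N k * s.
      by apply: lt_le_trans (convex_ge_min _ k01); rewrite lt_min ltr01.
    move: (node N k) k0 => a a0 w0; field.
    by rewrite gt_eqF//= gt_eqF.
  exact: ln_riemann.
have sC : (s - 1) ^+ 2 / s <= C.
  apply: (@le_trans _ _ ((1 + M) ^+ 2 / m)); last by rewrite lerDl.
  apply: ler_pM; rewrite ?sqr_ge0 ?invr_ge0 ?(ltW s0)//;
    last by rewrite lef_pV2.
  by rewrite -subr_ge0 subr_sqr mulr_ge0//; lra.
move=> /andP[h1 h2]; rewrite distrC ger0_norm ?subr_ge0//.
rewrite lerBlDl; apply: le_trans h2 _; rewrite lerD2l.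
apply: (@le_trans _ _ (N.+1%:R^-1 * C)); first by rewrite ler_wpM2l.
by rewrite -ler_pdivlMr// ltW.
Qed.

End ScalarApproximation.

(** * Jensen's inequality for x log x *)

Section EntropyInequality.
Set Implicit Arguments.
Unset Strict Implicit.
Variables (R : realType) (H : completeNormedModType R[i]).
Variables (ip : {dot H for Num.conj}) (ip_norm : norm_of_inner_product ip).
Implicit Types (x y z : H) (T S X Y Z A : H -> H) (a c m e : R).
Local Notation rdot := (rdot ip).
Local Notation self_adjoint := (self_adjoint ip).
Local Notation coercive := (coercive ip).

Lemma coercive_spectrum A m : self_adjoint A -> coercive m A ->
  exists M, forall s, real_spectrum A s -> m <= s <= M.
Proof.
move=> sA cA; have [M _ hM] := rdot_bounded ip_norm sA.1.
exists M; apply: (real_spectrum_bound ip_norm) => // x.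
exact: le_trans (ler_norm _) (hM x).
Qed.

(** * Resolvents and Riemann sums of a single operator *)

Section FixedOperator.
Variables (A : H -> H) (m : R).
Hypotheses (sA : self_adjoint A) (m0 : 0 < m) (cA : coercive m A).

Lemma spectrum_gt0 s : real_spectrum A s -> 0 < s.
Proof.
by have [M hM] := coercive_spectrum sA cA; move=> /hM/andP[/(lt_le_trans m0)].
Qed.

Lemma calculus_xln : approx_calculus (fun s => s * ln s) A
  (A \o log_operator A).
Proof.
apply: (calculusX ip_norm) => //; apply: (functional_calculusP ip_norm) => //.
by have [M] := coercive_spectrum sA cA; exact: approximable_ln.
Qed.

Lemma self_adjoint_xln : self_adjoint (A \o log_operator A).
Proof. exact: (calculus_self_adjoint ip_norm sA calculus_xln). Qed.

Section Resolvent.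
Variable a : R.
Hypothesis a01 : 0 <= a <= 1.

Definition affine_operator := (1 - a)%:C *: idfun + a%:C *: A.
(** As a value of the functional calculus, the inverse can be compared with other functions of [A]
    through its scalar function. *)
Definition affine_inverse := functional_calculus (fun s => (1 - a + a * s)^-1)
  A.

Lemma affine_gt0 s : real_spectrum A s -> 0 < 1 - a + a * s.
Proof.
move=> /spectrum_gt0 s0; apply: lt_le_trans (convex_ge_min s a01).
by rewrite lt_min ltr01.
Qed.

Lemma calculus_affine_inverse :
  approx_calculus (fun s => (1 - a + a * s)^-1) A affine_inverse.
Proof.
apply: (functional_calculusP ip_norm) => //.
have [M hM] := coercive_spectrum sA cA; have [a0 a1] := andP a01.
apply: (@approximable_inv _ _ _ _ (Num.min 1 m) (1 + `|M|)).
- by rewrite lt_min ltr01.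
- by rewrite ge_min lerDl normr_ge0.
move=> s /hM/andP[ms sM]; apply/andP; split.
  apply: le_trans (convex_ge_min _ a01).
  by rewrite le_min !ge_min lexx ms orbT.
apply: lerD; first by rewrite gerBl.
rewrite (le_trans _ (ler_norm _))// (le_trans _ sM)// ger_pMl//.
exact: lt_le_trans ms.
Qed.

(** With [V] the candidate inverse, [(1 - a) V + a A V] and the identity both correspond to the
    constant 1 on the spectrum, so uniqueness applies. *)
Lemma affine_inverseK y : affine_operator (affine_inverse y) = y.
Proof.
have h1 := calculusD (calculusZ (1 - a) calculus_affine_inverse)
  (calculusZ a (calculusX ip_norm sA calculus_affine_inverse)).
have h2 := calculus_poly 1%:P sA.1.
have /(congr1 (@^~ y)) : (1 - a)%:C *: affine_inverse + a%:C *: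
  (A \o affine_inverse) =
    poly_operator 1%:P A.
  apply: (calculus_unique ip_norm sA _ h1 h2) => s As.
  by rewrite hornerC mulrA -mulrDl mulfV// gt_eqF// affine_gt0.
by rewrite poly_operatorC !fctE scale1r.
Qed.

Lemma self_adjoint_affine : self_adjoint affine_operator.
Proof.
by apply: self_adjointD; apply: self_adjointZ => //; exact: self_adjoint_id.
Qed.

(* Equality holds at z = affine_inverse y, so the inverse is a supremum of
   functions that are affine in A. *)
Lemma affine_inverse_ge y z :
  2 * rdot y z - rdot (affine_operator z) z <= rdot (affine_inverse y) y.
Proof.
have sV := calculus_self_adjoint ip_norm sA calculus_affine_inverse.
have /self_adjointP[_ hV] := sV;
  have /self_adjointP[_ hW] := self_adjoint_affine.
have pV : psd ip affine_inverse.
  apply: (calculus_psd ip_norm sA _ calculus_affine_inverse) => s As.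
  by rewrite invr_ge0 ltW// affine_gt0.
(* With [W] the affine operator and [V] its inverse, the claim is [<V (y - W z), y - W z> >= 0]
   expanded. *)
have := pV (y - affine_operator z).
rewrite rdotBr -hW affine_inverseK hV rdotBl hW affine_inverseK rdotBl.
by rewrite (rdotC ip z) (rdotC ip y (affine_inverse y)); lra.
Qed.

Lemma affine_inverse_eq y (z := affine_inverse y) :
  rdot (affine_inverse y) y = 2 * rdot y z - rdot (affine_operator z) z.
Proof. by rewrite affine_inverseK (rdotC ip y z); lra. Qed.

End Resolvent.

(* By [ln_riemann], s ln s is approximated by Riemann sums of s (s - 1) / w,
   where w = 1 - a + a s, and a^2 s (s - 1) / w = a s - 1 + (1 - a) / w. *)
Definition riemann_form N y : R := \sum_(k < N.+1) N.+1%:R^-1 *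
  ((node R N k)^-2 * (node R N k * rdot (A y) y - rdot y y +
     (1 - node R N k) * rdot (affine_inverse (node R N k) y) y)).

Definition riemann_operator N : H -> H := \sum_(k < N.+1) (N.+1%:R^-1)%:C *:
  (((node R N k)^-2)%:C *: (poly_operator (node R N k *: 'X - 1%:P) A +
     (1 - node R N k)%:C *: affine_inverse (node R N k))).

Lemma riemann_operatorE N y : rdot (riemann_operator N y) y = riemann_form N y.
Proof.
rewrite /riemann_operator fct_sumE rdot_suml; apply: eq_bigr => k _.
rewrite poly_operatorB poly_operatorZ poly_operatorX poly_operatorC !fctE.
by rewrite !(rdotZl, rdotBl, rdotDl) mul1r.
Qed.

Lemma node01 N (k : 'I_N.+1) : 0 <= node R N k <= 1.
Proof. by rewrite node_le1 ltW ?node_gt0. Qed.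

Lemma calculus_riemann N : approx_calculus
  (fun s => \sum_(k < N.+1) N.+1%:R^-1 *
     ((node R N k)^-2 * ((node R N k *: 'X - 1%:P).[s] +
       (1 - node R N k) * (1 - node R N k + node R N k * s)^-1)))
  A (riemann_operator N).
Proof.
apply: (calculus_sum (f := fun (k : 'I_N.+1) s => _)) => k.
do 2 apply: calculusZ; apply: calculusD; first by apply: calculus_poly;
  exact: sA.1.
by apply: calculusZ; apply: calculus_affine_inverse; exact: node01.
Qed.

Lemma riemann_sumE N s : 0 < s ->
  \sum_(k < N.+1) N.+1%:R^-1 *
     ((node R N k)^-2 * ((node R N k *: 'X - 1%:P).[s] +
       (1 - node R N k) * (1 - node R N k + node R N k * s)^-1)) =
  s * \sum_(k < N.+1) N.+1%:R^-1 *
    ((s - 1) / (1 - node R N k + node R N k * s)).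
Proof.
move=> s0; rewrite mulr_sumr; apply: eq_bigr => k _; rewrite [RHS]mulrCA;
  congr (_ * _).
have w0 : 0 < 1 - node R N k + node R N k * s.
  by apply: lt_le_trans (convex_ge_min s (node01 k)); rewrite lt_min ltr01.
rewrite !(hornerD, hornerN, hornerZ, hornerX, hornerC);
  move: (node R N k) (node_gt0 R N k) w0 => a a0 w0.
by field; rewrite !gt_eqF.
Qed.

Lemma xln_ge_riemann N y : riemann_form N y <= rdot (A (log_operator A y)) y.
Proof.
have h := calculusD calculus_xln (calculusZ (-1) (calculus_riemann N)).
have /(calculus_psd ip_norm sA)/(_ h)/(_ y) : forall s, real_spectrum A s ->
    0 <= s * ln s + -1 * \sum_(k < N.+1) N.+1%:R^-1 *
     ((node R N k)^-2 * ((node R N k *: 'X - 1%:P).[s] +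
       (1 - node R N k) * (1 - node R N k + node R N k * s)^-1)).
  move=> s /spectrum_gt0 s0; rewrite riemann_sumE// mulN1r -mulrBr.
  by rewrite mulr_ge0 ?(ltW s0)// subr_ge0; have /andP[] := ln_riemann N s0.
by rewrite !fctE rdotDl rdotZl mulN1r subr_ge0 riemann_operatorE.
Qed.

(** Multiplication by [s] turns the scalar error [(s - 1)^2 / s] into the polynomial [(s - 1)^2],
    whose form at [y] is [|A y - y|^2]. *)
Lemma xln_le_riemann N y :
  rdot (A (log_operator A y)) y <= riemann_form N y + N.+1%:R^-1 * rnorm
    (A y - y) ^+ 2.
Proof.
pose q : {poly R} := ('X - 1%:P) * ('X - 1%:P).
have h := calculusD (calculusD (calculus_riemann N)
  (calculusZ N.+1%:R^-1 (calculus_poly q sA.1))) (calculusZ (-1) calculus_xln).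
have /(calculus_psd ip_norm sA)/(_ h)/(_ y) : forall s, real_spectrum A s ->
    0 <= \sum_(k < N.+1) N.+1%:R^-1 *
     ((node R N k)^-2 * ((node R N k *: 'X - 1%:P).[s] +
       (1 - node R N k) * (1 - node R N k + node R N k * s)^-1)) +
    N.+1%:R^-1 * q.[s] + -1 * (s * ln s).
  move=> s /spectrum_gt0 s0; rewrite riemann_sumE// mulN1r subr_ge0.
  have /andP[_ h1] := ln_riemann N s0;
    apply: (le_trans (ler_wpM2l (ltW s0) h1)).
  rewrite mulrDr lerD2l le_eqVlt; apply/orP; left; apply/eqP.
  rewrite /q hornerM !(hornerD, hornerN, hornerX, hornerC). field.
  by rewrite nat1r pnatr_eq0 (gt_eqF s0).
have lA := bounded_linear sA.1; have /self_adjointP[_ hA] := sA.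
have qE : rdot (poly_operator q A y) y = rnorm (A y - y) ^+ 2.
  rewrite poly_operatorM// poly_operatorB poly_operatorX poly_operatorC !fctE
    /=.
  by rewrite !scale1r rdotBl hA -rdotBr (rdotxx ip_norm).
by rewrite !fctE !rdotDl !rdotZl riemann_operatorE qE mulN1r subr_ge0.
Qed.

End FixedOperator.

(** * Convex combinations of operators *)

Section Jensen.
Variables (n : nat) (A : 'I_n -> H -> H) (m : R) (d : 'I_n -> R).
Hypotheses (sA : forall j, self_adjoint (A j)) (m0 : 0 < m).
Hypotheses (cA : forall j, coercive m (A j)).
Hypotheses (d0 : forall j, 0 <= d j) (d1 : \sum_j d j = 1).
Let X := \sum_(j < n) (d j)%:C *: A j.

Lemma rdot_mix y z : rdot (X y) z = \sum_j d j * rdot (A j y) z.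
Proof.
by rewrite /X fct_sumE rdot_suml; apply: eq_bigr => j _; rewrite fctE rdotZl.
Qed.

Lemma self_adjoint_mix : self_adjoint X.
Proof. by apply: self_adjoint_sum => j _; exact: self_adjointZ. Qed.

Lemma coercive_mix : coercive m X.
Proof.
move=> y; rewrite rdot_mix -[leLHS]mul1r -d1 mulr_suml.
by apply: ler_sum => j _; rewrite ler_wpM2l// cA.
Qed.

(** The vector [z] attaining the maximum for [X] is a competitor for every [A j], and the maximised
    expression is affine in the operator. *)
Lemma jensen_affine_inverse a y : 0 <= a <= 1 ->
  rdot (affine_inverse X a y) y <= \sum_j d j * rdot (affine_inverse (A j) a y)
    y.
Proof.
move=> a01; have sX := self_adjoint_mix; have cX := coercive_mix.
rewrite (affine_inverse_eq sX m0 cX a01); set z := affine_inverse X a y.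
apply: (@le_trans _ _ (\sum_j d j *
  (2 * rdot y z - rdot (affine_operator (A j) a z) z))).
  rewrite le_eqVlt; apply/orP; left; apply/eqP.
  rewrite /affine_operator !fctE rdotDl !rdotZl rdot_mix.
  have dE u : u = \sum_j d j * u by rewrite -mulr_suml d1 mul1r.
  rewrite {1}(dE (2 * rdot y z)) {1}(dE ((1 - a) * rdot z z)) mulr_sumr
    -big_split/=.
  rewrite -sumrB; apply: eq_bigr => j _; rewrite !fctE rdotDl !rdotZl; ring.
apply: ler_sum => j _; rewrite ler_wpM2l//.
exact: (affine_inverse_ge (sA j) m0 (cA j) a01).
Qed.

(** Apart from the inverse, each summand is affine in the operator; the inverse has the nonnegative
    coefficient [(1 - a) / a^2], up to the common weight. *)
Lemma jensen_riemann N y :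
  riemann_form X N y <= \sum_j d j * riemann_form (A j) N y.
Proof.
rewrite /riemann_form; under [leRHS]eq_bigr do rewrite mulr_sumr.
rewrite exchange_big /=; apply: ler_sum => k _.
under [leRHS]eq_bigr do rewrite mulrCA.
rewrite -mulr_sumr ler_wpM2l ?invr_ge0//.
under [leRHS]eq_bigr do rewrite mulrCA.
rewrite -mulr_sumr ler_wpM2l ?invr_ge0 ?exprn_ge0 ?(ltW (node_gt0 _ _ _))//.
move: (node R N k) (node01 k) => a a01; have [a0 a1] := andP a01.
have -> : \sum_(j < n) d j * (a * rdot (A j y) y - rdot y y +
      (1 - a) * rdot (affine_inverse (A j) a y) y) =
    a * rdot (X y) y - rdot y y +
      (1 - a) * \sum_j d j * rdot (affine_inverse (A j) a y) y.
  have dE : rdot y y = \sum_j d j * rdot y y by rewrite -mulr_suml d1 mul1r.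
  rewrite [in RHS]dE rdot_mix !mulr_sumr -sumrB -big_split/=.
  by apply: eq_bigr => j _; ring.
by rewrite lerD2l ler_wpM2l ?subr_ge0// jensen_affine_inverse.
Qed.

(** Three estimates are chained: from above for [X], convexity of the Riemann form, from below for
    each [A j]. The only error, [|X y - y|^2 / (N + 1)], tends to 0. *)
Lemma jensen_xln y : rdot (X (log_operator X y)) y <=
  \sum_j d j * rdot (A j (log_operator (A j) y)) y.
Proof.
rewrite -subr_le0; apply: (@le_harmonic0 _ _ (rnorm (X y - y) ^+ 2)) => N.
have h1 := xln_le_riemann self_adjoint_mix m0 coercive_mix N y.
have h2 := jensen_riemann N y.
have h3 : \sum_j d j * riemann_form (A j) N y <=
    \sum_j d j * rdot (A j (log_operator (A j) y)) y.
  apply: ler_sum => j _; rewrite ler_wpM2l//.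
  exact: (xln_ge_riemann (sA j) m0 (cA j)).
by rewrite lerBlDl; apply: le_trans h1 _; rewrite lerD2r; exact: le_trans h2 h3.
Qed.

End Jensen.

(** On scalars this is the tangent of the convex function [s ln s] at [s = 1 / n]. *)
Lemma xln_ge_tangent A m (n : nat) y : self_adjoint A -> 0 < m -> coercive m A
  ->
  (0 < n)%N -> (1 - ln n%:R) * rdot (A y) y - n%:R^-1 * rdot y y <=
  rdot (A (log_operator A y)) y.
Proof.
move=> sA m0 cA n0; have n0' : 0 < n%:R :> R by rewrite ltr0n.
pose q : {poly R} := (ln n%:R - 1) *: 'X + n%:R^-1%:P.
have h := calculusD (calculus_xln sA m0 cA) (calculus_poly q sA.1).
have /(calculus_psd ip_norm sA)/(_ h)/(_ y) : forall s, real_spectrum A s ->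
    0 <= s * ln s + q.[s].
  move=> s /(spectrum_gt0 sA m0 cA) s0;
    rewrite !(hornerD, hornerZ, hornerX, hornerC).
  have ns0 : 0 < n%:R * s by rewrite mulr_gt0.
  (* [ln x <= x - 1] at [x = 1 / (n s)], afterwards multiplied by [s]. *)
  have := ln_le_sub1 (divr_gt0 ltr01 ns0);
    rewrite mul1r lnV ?posrE// lnM ?posrE//.
  rewrite -(ler_pM2l s0) => h1.
  have e : s * ((n%:R * s)^-1 - 1) = n%:R^-1 - s by field; rewrite !gt_eqF.
  by move: h1; rewrite e; move: (ln s) (ln n%:R) (n%:R^-1) => u v w; nra.
rewrite !fctE poly_operatorD poly_operatorZ poly_operatorX poly_operatorC !fctE.
by rewrite !rdotDl !rdotZl /=; move: (ln _) (n%:R^-1) => v w; nra.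
Qed.

End EntropyInequality.

(** * Doubly stochastic weights and the two entropy bounds *)

Lemma positive_lower_bound (R : realType) (n : nat) (c : 'I_n -> R) :
  (forall j, 0 < c j) -> exists2 m, 0 < m & forall j, m <= c j.
Proof.
move=> c0; have s0 : 0 <= \sum_j (c j)^-1 by apply: sumr_ge0 => j _;
  rewrite invr_ge0 ltW.
(* [1 / m] exceeds every [1 / c j]; the summand 1 keeps it positive for [n = 0] as well. *)
exists (1 + \sum_j (c j)^-1)^-1; first by rewrite invr_gt0 ltr_wpDr.
move=> j; rewrite -[leRHS]invrK lef_pV2 ?posrE ?invr_gt0 ?ltr_wpDr//.
rewrite (bigD1 j)//= addrCA lerDl addr_ge0// sumr_ge0// => i _.
by rewrite invr_ge0 ltW.
Qed.

Lemma doubly_stochastic_convex (R : realType) (n : nat) (B C : 'M[R]_n)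
    (t : R) :
  doubly_stochastic B -> doubly_stochastic C -> 0 <= t -> t <= 1 ->
  doubly_stochastic (\matrix_(i, j) ((1 - t) * B i j + t * C i j)).
Proof.
move=> [B0 Br Bc] [C0 Cr Cc] t0 t1; split.
- by move=> i j; rewrite mxE addr_ge0// mulr_ge0// subr_ge0.
- move=> i; under eq_bigr do rewrite mxE.
  by rewrite big_split/= -!mulr_sumr Br Cr; ring.
- move=> j; under eq_bigr do rewrite mxE.
  by rewrite big_split/= -!mulr_sumr Bc Cc; ring.
Qed.

Theorem corollary2p11 (R : realType) (H : completeNormedModType R[i])
    (ip : {dot H for Num.conj}) (ip_norm : norm_of_inner_product ip)
    (n : nat) (J : interval R) (A : 'I_n -> H -> H)
    (A_pos : forall j, positive_operator ip (A j))
    (A_inv : forall j, invertible_operator (A j))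
    (A_spec : forall j, spectrum (A j) `<=` [set s%:C | s in [set` J]])
    (A_sum : \sum_(j < n) A j = idfun)
    (B C : 'M[R]_n) (B_ds : doubly_stochastic B) (C_ds : doubly_stochastic C)
    (t : R) (t_ge0 : 0 <= t) (t_le1 : t <= 1) :
  let X i := \sum_(j < n) ((1 - t) * B i j + t * C i j)%:C *: A j in
  let S := \sum_(i < n) - (X i \o log_operator (X i)) in
  operator_le ip S ((ln n%:R)%:C *: idfun) /\
  operator_le ip (- \sum_(j < n) (A j \o log_operator (A j))) S.
Proof.
move=> X S.
have sA j : self_adjoint ip (A j) by case: (A_pos j).
(* Positive invertible operators are coercive; a common constant [m] then keeps the spectra of all
   [A j] and [X i] away from 0, where [ln] is singular. *)
have /choice[c hc] j : exists c, 0 < c /\ coercive ip c (A j).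
  have /positive_operatorP[_ _ pA] := A_pos j.
  by have [c] := psd_invertible_coercive ip_norm (sA j) pA (A_inv j); exists c.
have [m m0 mc] := positive_lower_bound (fun j => (hc j).1).
have cA j : coercive ip m (A j).
  by move=> x; apply: le_trans ((hc j).2 x);
    rewrite ler_wpM2r ?exprn_ge0 ?rnorm_ge0.
have [D0 Dr Dc] := doubly_stochastic_convex B_ds C_ds t_ge0 t_le1.
set D := (\matrix_(i, j) _) in D0 Dr Dc.
have XE i : X i = \sum_(j < n) (D i j)%:C *: A j by apply: eq_bigr => j _;
  rewrite mxE.
have sX i : self_adjoint ip (X i) by rewrite XE; exact: self_adjoint_mix.
have cX i : coercive ip m (X i) by rewrite XE; exact: coercive_mix.
have sS : self_adjoint ip S.
  apply: self_adjoint_sum => i _; apply: self_adjointN.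
  exact: (self_adjoint_xln ip_norm (sX i) m0 (cX i)).
have sAln : self_adjoint ip (\sum_(j < n) (A j \o log_operator (A j))).
  by apply: self_adjoint_sum => j _;
    exact: (self_adjoint_xln ip_norm (sA j) m0 (cA j)).
have sI a : self_adjoint ip (a%:C *: (idfun : H -> H)).
  by apply: self_adjointZ; exact: self_adjoint_id.
have SE y : rdot ip (S y) y = - \sum_i rdot ip (X i (log_operator (X i) y)) y.
  by rewrite /S fct_sumE rdot_suml -sumrN; apply: eq_bigr => i _;
    rewrite fctE rdotNl.
have AE y : \sum_j rdot ip (A j y) y = rdot ip y y.
  by rewrite -rdot_suml; have /(congr1 (@^~ y)) := A_sum;
    rewrite fct_sumE => ->.
(* Exchanging the sums brings out the column sums of [D], which are 1. *)
have XsumE y : \sum_i rdot ip (X i y) y = rdot ip y y.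
  rewrite -AE; under eq_bigr do rewrite XE rdot_mix.
  by rewrite exchange_big; apply: eq_bigr => j _; rewrite -mulr_suml Dc mul1r.
split; split=> //.
- apply/positive_operatorP;
  have /self_adjointP[bT hT] := self_adjointB (sI (ln n%:R)) sS.
  split=> // y; rewrite fctE rdotBl SE fctE rdotZl opprK.
  (* For [n = 0] the identity is an empty sum, so [<y, y>] vanishes. *)
  have [n0|n0] := posnP n.
    have I0 (F : 'I_n -> R) : \sum_i F i = 0.
      by rewrite big1// => -[k kn]; exfalso; rewrite n0 in kn.
    by rewrite -AE !I0 mulr0 addr0.
  (* The tangents add up to [(1 - ln n) - n / n = - ln n] times [<y, y>]. *)
  have : \sum_i ((1 - ln n%:R) * rdot ip (X i y) y - n%:R^-1 * rdot ip y y) <=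
      \sum_i rdot ip (X i (log_operator (X i) y)) y.
    by apply: ler_sum => i _;
      exact: (xln_ge_tangent ip_norm y (sX i) m0 (cX i)).
  rewrite sumrB -mulr_sumr XsumE sumr_const card_ord -[_ * _ *+ _]mulr_natl
    mulrA mulfV ?mul1r; last first.
    by rewrite pnatr_eq0 -lt0n.
  by move: (ln _) => v /=; lra.
- exact: self_adjointN.
- apply/positive_operatorP.
  have /self_adjointP[bT hT] := self_adjointB sS (self_adjointN sAln).
  split=> // y; rewrite fctE rdotBl SE fctE rdotNl opprK addrC subr_ge0.
  rewrite fct_sumE rdot_suml.
  (* Jensen's inequality for each row of [D], whose row sums are 1; the column sums then remove the
     weights. *)
  apply: (@le_trans _ _ (\sum_i \sum_j D i j * rdot ip
    (A j (log_operator (A j) y)) y)).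
    by apply: ler_sum => i _; rewrite XE; exact: (jensen_xln ip_norm sA m0 cA).
  rewrite exchange_big le_eqVlt; apply/orP; left; apply/eqP;
    apply: eq_bigr => j _.
  by rewrite -mulr_suml Dc mul1r.
Qed.
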